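(* Let $\phi$ be an unsatisfiable CNF formula with clauses $\kappa_1,\dots,\kappa_m$, and let $f_1,\dots,f_m$ be the non-commutative formulas $f_i=\mathrm{tr}(\kappa_i)$. If there is a non-commutative IPS refutation of $f_1,\dots,f_m$ over $GF(2)$ of size $s$, then there is a Frege proof of the tautology $\neg\phi$ of size $s^{O(\log s)}$.
   Formalization: The Frege proof size is bounded by N^{O(log N)} with N = s + |φ| instead of s^{O(log s)}; the literal bound fails when φ is much larger than s, since the proof must contain ¬φ, and the two bounds agree when |φ| is at most polynomial in s. *)

(* Defs.v *)
From HB Require Import structures.
From mathcomp Require Import all_boot all_order all_algebra.
Set Implicit Arguments. Unset Strict Implicit. Unset Printing Implicit Defensive.
Import GRing.Theory.
Local Open Scope ring_scope.

Definition lit := (nat * bool)%type.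
Definition clause := seq lit.
Definition cnf := seq clause.

Definition lit_true (a : nat -> bool) (l : lit) : bool :=
  if l.2 then a l.1 else ~~ a l.1.
Definition clause_true (a : nat -> bool) (k : clause) : bool :=
  has (lit_true a) k.
Definition cnf_true (a : nat -> bool) (phi : cnf) : bool :=
  all (clause_true a) phi.
Definition satisfiable (phi : cnf) : Prop := exists a, cnf_true a phi.

(* number of variables: variables of phi are x_0, ..., x_(nvars phi - 1) *)
Definition nvars (phi : cnf) : nat :=
  (\max_(k <- phi) \max_(l <- k) l.1.+1)%N.

Inductive ncf (V : Type) : Type :=
| NVar of V
| NConst of 'F_2
| NAdd of ncf V & ncf V
| NMul of ncf V & ncf V.
Arguments NConst {V}.

Fixpoint ncf_size V (f : ncf V) : nat :=
  match f with
  | NVar _ | NConst _ => 1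
  | NAdd g h | NMul g h => (ncf_size g + ncf_size h).+1
  end.

(* The non-commutative polynomial computed by a formula, given by its
   coefficient function on words (non-commutative monomials). *)
Fixpoint ncoef (V : eqType) (f : ncf V) (w : seq V) : 'F_2 :=
  match f with
  | NVar v => (w == [:: v])%:R
  | NConst a => if w == [::] then a else 0
  | NAdd g h => ncoef g w + ncoef h w
  | NMul g h => \sum_(i < (size w).+1) ncoef g (take i w) * ncoef h (drop i w)
  end.

Definition nc_eq (V : eqType) (f g : ncf V) : Prop :=
  forall w, ncoef f w = ncoef g w.

Fixpoint nsubst V W (s : V -> ncf W) (f : ncf V) : ncf W :=
  match f with
  | NVar v => s v
  | NConst a => NConst a
  | NAdd g h => NAdd (nsubst s g) (nsubst s h)
  | NMul g h => NMul (nsubst s g) (nsubst s h)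
  end.

Local Close Scope ring_scope.

Definition tr_lit (l : lit) : ncf nat :=
  if l.2 then NAdd (NConst 1%R) (NMul (NConst (-1)%R) (NVar l.1))
  else NVar l.1.
Definition tr (k : clause) : ncf nat :=
  foldr (fun l acc => NMul (tr_lit l) acc) (NConst 1%R) k.

(* Variables of an IPS certificate C(x, y, z, w): x_i original variables,
   y_i placeholders for the axioms f_i, z_i placeholders for the Boolean
   axioms x_i^2 - x_i, w_(i,j) placeholders for the commutator axioms
   x_i x_j - x_j x_i. *)
Definition ipsvar := (nat + nat + nat + (nat * nat))%type.
Definition vX i : ipsvar := inl (inl (inl i)).
Definition vY i : ipsvar := inl (inl (inr i)).
Definition vZ i : ipsvar := inl (inr i).
Definition vW i j : ipsvar := inr (i, j).

Definition nsub (f g : ncf nat) : ncf nat := NAdd f (NMul (NConst (-1)%R) g).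

Definition subst_zero (v : ipsvar) : ncf nat :=
  match v with
  | inl (inl (inl i)) => NVar i
  | _ => NConst 0%R
  end.

(* substitution C(x, f, x^2 - x, [x_i,x_j]); placeholder variables with
   out-of-range indices are set to 0 (i.e. they are not available). *)
Definition subst_axioms (n : nat) (fs : seq (ncf nat)) (v : ipsvar) : ncf nat :=
  match v with
  | inl (inl (inl i)) => NVar i
  | inl (inl (inr i)) => if i < size fs then nth (NConst 0%R) fs i else NConst 0%R
  | inl (inr i) =>
      if i < n then nsub (NMul (NVar i) (NVar i)) (NVar i) else NConst 0%R
  | inr (i, j) =>
      if (i < j) && (j < n)
      then nsub (NMul (NVar i) (NVar j)) (NMul (NVar j) (NVar i))
      else NConst 0%R
  end.

Definition nc_ips_refutation (n : nat) (fs : seq (ncf nat)) (C : ncf ipsvar) : Prop :=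
  nc_eq (nsubst subst_zero C) (NConst 0%R) /\
  nc_eq (nsubst (subst_axioms n fs) C) (NConst 1%R).

(* Propositional formulas and a (standard) Frege system: Kleene's
   Hilbert-style system for classical propositional logic with
   connectives ->, /\, \/, ~ and the constant False, rule modus ponens. *)
Inductive pform : Type :=
| PVar of nat
| PBot
| PNot of pform
| PAnd of pform & pform
| POr of pform & pform
| PImp of pform & pform.

Fixpoint psize (A : pform) : nat :=
  match A with
  | PVar _ | PBot => 1
  | PNot B => (psize B).+1
  | PAnd B C | POr B C | PImp B C => (psize B + psize C).+1
  end.

Inductive frege_axiom : pform -> Prop :=
| Ax1 A B : frege_axiom (PImp A (PImp B A))
| Ax2 A B C : frege_axiom
    (PImp (PImp A B) (PImp (PImp A (PImp B C)) (PImp A C)))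
| Ax3 A B : frege_axiom (PImp A (PImp B (PAnd A B)))
| Ax4a A B : frege_axiom (PImp (PAnd A B) A)
| Ax4b A B : frege_axiom (PImp (PAnd A B) B)
| Ax5a A B : frege_axiom (PImp A (POr A B))
| Ax5b A B : frege_axiom (PImp B (POr A B))
| Ax6 A B C : frege_axiom
    (PImp (PImp A C) (PImp (PImp B C) (PImp (POr A B) C)))
| Ax7 A B : frege_axiom (PImp (PImp A B) (PImp (PImp A (PNot B)) (PNot A)))
| Ax8 A : frege_axiom (PImp (PNot (PNot A)) A)
| AxBot : frege_axiom (PNot PBot).

Definition frege_proof (pf : seq pform) (A : pform) : Prop :=
  pf <> [::] /\ last PBot pf = A /\
  forall i, i < size pf ->
    frege_axiom (nth PBot pf i) \/
    exists j k, [/\ j < i, k < i & nth PBot pf k = PImp (nth PBot pf j) (nth PBot pf i)].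

Definition proof_size (pf : seq pform) : nat := \sum_(A <- pf) psize A.

Definition plit (l : lit) : pform := if l.2 then PVar l.1 else PNot (PVar l.1).

Fixpoint bigor (s : seq pform) : pform :=
  match s with
  | [::] => PBot
  | [:: a] => a
  | a :: s' => POr a (bigor s')
  end.

Fixpoint bigand (s : seq pform) : pform :=
  match s with
  | [::] => PNot PBot
  | [:: a] => a
  | a :: s' => PAnd a (bigand s')
  end.

Definition cnf_form (phi : cnf) : pform :=
  bigand [seq bigor (map plit k) | k <- phi].

Definition cnf_size (phi : cnf) : nat := psize (cnf_form phi).

(* Main.v *)
(** A sum modulo 2 doubles a formula at every level, so a certificate is Booleanized along its heavy
    path: the value of a formula is a balanced exclusive or of products of values of light
    siblings.  Light siblings have at most half the size, so the value has size N^O(log N), and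
    Frege proves in polynomially many lines that taking values commutes with + and *.

    A non-commutative formula [F] that computes 0 has a provably false value.  Reading [F] from left
    to right, every prefix is a GF(2)-combination of generators p_0 = 1 and p_j = Q_j x, where Q_j
    is itself a combination of the p_i with i < j.  Since right division by a variable is well
    defined on non-commutative polynomials, it turns a linear relation among p_0, ..., p_k into
    relations among p_0, ..., p_(k-1), from which the former is derived.  Over GF(2) it suffices to
    derive one relation for each possible top generator.

    Under the hypothesis phi, every axiom substituted into the certificate C has a false value, so
    C(x, 0) and C(x, axioms) have equivalent values; but C(x, 0) and C(x, axioms) + 1 both compute
    0, a contradiction. *)
Require Import Defs.
From mathcomp Require Import all_boot all_order all_algebra.
From mathcomp Require Import zify.
From Stdlib Require List.
From Stdlib Require Import Classical.
Import GRing.Theory.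

Set Implicit Arguments.
Unset Strict Implicit.
Unset Printing Implicit Defensive.

Local Notation In := List.In.
Local Notation incl l l' := (forall x, In x l -> In x l').

(** The number of lines and their sizes are accounted for separately. One depth [d], with [2 ^ d]
    polynomial in N, is fixed throughout: the number of lines is at most a constant times a power of
    [2 ^ d], and formulas substituted into inferences have size at most [msize d], which is
    2^O(d^2). All inferences are instances of tautologies of bounded size, so completeness of the
    Frege system bounds their proofs by one constant and none has to be written out.

    The obstacle is the identity test. The polynomial of F may have exponentially many monomials, so
    F cannot be expanded; only prefixes are tracked, with one generator per occurrence of a
    variable. Division works because a word has a unique last letter: the generators ending in x can
    be compared apart from the others. The relations need not be computed, only exist, so excluded
    middle selects them. Values, in contrast, commute and are idempotent, so the Boolean and
    commutator axioms have provably false values without any use of phi. *)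

Fixpoint peval (a : nat -> bool) (A : pform) : bool :=
  match A with
  | PVar i => a i
  | PBot => false
  | PNot B => ~~ peval a B
  | PAnd B C => peval a B && peval a C
  | POr B C => peval a B || peval a C
  | PImp B C => peval a B ==> peval a C
  end.

Fixpoint psub (s : nat -> pform) (A : pform) : pform :=
  match A with
  | PVar i => s i
  | PBot => PBot
  | PNot B => PNot (psub s B)
  | PAnd B C => PAnd (psub s B) (psub s C)
  | POr B C => POr (psub s B) (psub s C)
  | PImp B C => PImp (psub s B) (psub s C)
  end.

Fixpoint pbelow (k : nat) (A : pform) : bool :=
  match A with
  | PVar i => i < k
  | PBot => true
  | PNot B => pbelow k B
  | PAnd B C | POr B C | PImp B C => pbelow k B && pbelow k C
  end.

Lemma In_map_f (T U : Type) (f : T -> U) l x : In x l -> In (f x) (map f l).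
Proof. by elim: l => //= y l IH [->|/IH]; [left|right]. Qed.

Lemma In_map (T U : Type) (f : T -> U) l y : In y (map f l) -> exists x, f x = y /\ In x l.
Proof.
elim: l => //= x l IH [<-|/IH[z [e i]]]; first by exists x; split=> //; left.
by exists z; split=> //; right.
Qed.

Lemma In_catI (T : Type) (l1 l2 : seq T) x : In x l1 \/ In x l2 -> In x (l1 ++ l2).
Proof.
elim: l1 => [|y l IH] /= [] //; last by move=> i; right; apply: IH; right.
by case=> [->|i]; [left|right; apply: IH; left].
Qed.

Lemma In_catE (T : Type) (l1 l2 : seq T) x : In x (l1 ++ l2) -> In x l1 \/ In x l2.
Proof.
elim: l1 => [|y l IH] /=; first by right.
by case=> [->|/IH[]]; [left; left|left; right|right].
Qed.

(** * Completeness of the Frege system *)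

Definition taut (A : pform) : Prop := forall a, peval a A.

(** Hypotheses form a list so that the deduction theorem is available. Nothing is counted:
    completeness is applied to finitely many fixed tautologies only. *)
Inductive prv (G : seq pform) : pform -> Prop :=
| prv_ax A : frege_axiom A -> prv G A
| prv_hyp A : In A G -> prv G A
| prv_mp A B : prv G A -> prv G (PImp A B) -> prv G B.

Lemma prv_sub G G' A : incl G G' -> prv G A -> prv G' A.
Proof.
move=> sGG'; elim=> [B|B /sGG'|B C _ h1 _ h2]; [exact: prv_ax|exact: prv_hyp|exact: prv_mp h1 h2].
Qed.

Lemma prv_cons G A B : prv G A -> prv (B :: G) A.
Proof. by apply: prv_sub => C; right. Qed.

Lemma prv_hd G A : prv (A :: G) A.
Proof. by apply: prv_hyp; left. Qed.

Lemma prv_ax1 G A B : frege_axiom (PImp A B) -> prv G A -> prv G B.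
Proof. by move=> ax pA; apply: prv_mp pA (prv_ax _ ax). Qed.

Lemma prv_ax2 G A B C : frege_axiom (PImp A (PImp B C)) -> prv G A -> prv G B -> prv G C.
Proof. by move=> ax pA pB; apply: prv_mp pB _; apply: prv_ax1 ax pA. Qed.

Lemma prv_id G A : prv G (PImp A A).
Proof.
by apply: (prv_ax2 (Ax2 A (PImp A A) A)); apply: prv_ax; apply: Ax1.
Qed.

Lemma prv_ded G A B : prv (A :: G) B -> prv G (PImp A B).
Proof.
elim=> [C ax|C|C D _ h1 _ h2].
- by apply: (prv_ax1 (Ax1 _ _)); apply: prv_ax.
- case=> [<-|iC]; first exact: prv_id.
  by apply: (prv_ax1 (Ax1 _ _)); apply: prv_hyp.
- by apply: (prv_ax2 (Ax2 _ _ _) h1 h2).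
Qed.

Lemma prv_negI G A B : prv (A :: G) B -> prv (A :: G) (PNot B) -> prv G (PNot A).
Proof. by move=> /prv_ded h1 /prv_ded h2; apply: (prv_ax2 (Ax7 _ _) h1 h2). Qed.

Lemma prv_absurd G B A : prv G B -> prv G (PNot B) -> prv G A.
Proof.
move=> h1 h2; apply: (prv_ax1 (Ax8 _)).
by apply: (prv_negI (B := B)); apply: prv_cons.
Qed.

Lemma prv_em G A B : prv (A :: G) B -> prv (PNot A :: G) B -> prv G B.
Proof.
move=> /prv_ded h1 /prv_ded h2; apply: (prv_ax1 (Ax8 _)).
apply: (prv_negI (B := B)); last exact: prv_hd.
apply: prv_mp (prv_cons _ h2).
apply: (prv_negI (B := B)).
  by apply: prv_mp (prv_hd _ _) _; do 2!apply: prv_cons.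
by apply: prv_cons; apply: prv_hd.
Qed.

Definition signed (a : nat -> bool) (A : pform) : pform :=
  if peval a A then A else PNot A.

Fixpoint literals (a : nat -> bool) (k : nat) : seq pform :=
  if k is k'.+1 then signed a (PVar k') :: literals a k' else [::].

Lemma literalsP a k i : i < k -> In (signed a (PVar i)) (literals a k).
Proof.
elim: k => //= k IH; rewrite ltnS leq_eqVlt => /orP[/eqP->|/IH]; by [left|right].
Qed.

Lemma eq_literals a b k : (forall i, i < k -> a i = b i) -> literals a k = literals b k.
Proof.
elim: k => //= k IH eqab; rewrite IH => [|i ik]; last by apply: eqab; rewrite ltnW.
by rewrite /signed /= eqab.
Qed.

(** Kalmar's argument: by induction on the formula, the signs of the variables derivably decide
    it. *)
Lemma prv_signed a k A : pbelow k A -> prv (literals a k) (signed a A).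
Proof.
elim: A => [i|_|B IB|B IB C IC|B IB C IC|B IB C IC] /=.
- by move=> /literalsP ik; apply: prv_hyp.
- by apply: prv_ax; apply: AxBot.
- move=> /IB; rewrite /signed /=; case: (peval a B) => //= h.
  by apply: (prv_negI (B := B)); [apply: prv_cons|apply: prv_hd].
- move=> /andP[/IB hB /IC hC]; move: hB hC; rewrite /signed /=.
  case: (peval a B) => /= hB.
    case: (peval a C) => /= hC; first exact: (prv_ax2 (Ax3 _ _) hB hC).
    by apply: (prv_negI (B := C)); [apply: (prv_ax1 (Ax4b _ _)); apply: prv_hd|apply: prv_cons].
  by move=> _; apply: (prv_negI (B := B)); [apply: (prv_ax1 (Ax4a _ _)); apply: prv_hd|apply: prv_cons].
- move=> /andP[/IB hB /IC hC]; move: hB hC; rewrite /signed /=.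
  case: (peval a B) => /= hB; first by move=> _; apply: (prv_ax1 (Ax5a _ _) hB).
  case: (peval a C) => /= hC; first exact: (prv_ax1 (Ax5b _ _) hC).
  apply: (prv_negI (B := PBot)); last by apply: prv_ax; apply: AxBot.
  apply: prv_mp (prv_hd _ _) _; apply: prv_cons.
  apply: (prv_ax2 (Ax6 _ _ _)); apply: prv_ded.
    by apply: (prv_absurd (B := B)); [apply: prv_hd|apply: prv_cons].
  by apply: (prv_absurd (B := C)); [apply: prv_hd|apply: prv_cons].
- move=> /andP[/IB hB /IC hC]; move: hB hC; rewrite /signed /=.
  case: (peval a C) => /= hB hC.
    by rewrite implybT; apply: (prv_ax1 (Ax1 _ _) hC).
  move: hB; case: (peval a B) => /= hB.
    apply: (prv_negI (B := C)); last exact: prv_cons.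
    by apply: prv_mp (prv_hd _ _); apply: prv_cons.
  by apply: prv_ded; apply: (prv_absurd (B := B)); [apply: prv_hd|apply: prv_cons].
Qed.

(** Variables are discharged from the top: two assignments that differ only at [k] share their
    literals below [k], and case analysis on [PVar k] merges them. *)
Lemma prv_literals k A : (forall a, prv (literals a k) A) -> prv [::] A.
Proof.
elim: k => [|k IH] h; first exact: (h (fun _ => true)).
apply: IH => a.
pose b v := fun i => if i == k then v else a i.
have eqb v : literals a k = literals (b v) k.
  by apply: eq_literals => i ik; rewrite /b ltn_eqF.
apply: (prv_em (A := PVar k)).
  by have := h (b true); rewrite /= -eqb /signed /= /b eqxx.
by have := h (b false); rewrite /= -eqb /signed /= /b eqxx.
Qed.

Lemma pbelow_mono k k' A : k <= k' -> pbelow k A -> pbelow k' A.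
Proof.
move=> kk'; elim: A => //= [i ik|B IB C IC|B IB C IC|B IB C IC]; first exact: leq_trans ik kk'.
all: by case/andP=> /IB-> /IC->.
Qed.

Lemma pbelow_ex A : exists k, pbelow k A.
Proof.
elim: A => [i|||B [k hk] C [l hl]|B [k hk] C [l hl]|B [k hk] C [l hl]] //=.
- by exists i.+1.
- by exists 0.
all: exists (maxn k l); rewrite (pbelow_mono (leq_maxl k l)) //.
all: by rewrite (pbelow_mono (leq_maxr k l)).
Qed.

Lemma prv_taut A : taut A -> prv [::] A.
Proof.
move=> tA; have [k kA] := pbelow_ex A.
by apply: (@prv_literals k) => a; have := prv_signed a kA; rewrite /signed tA.
Qed.

(** * Proof size of tautological inferences *)

(* Frege proofs, most recent line first *)
Inductive fseq : seq pform -> Prop :=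
| fseq_nil : fseq [::]
| fseq_ax A l : fseq l -> frege_axiom A -> fseq (A :: l)
| fseq_mp A B l : fseq l -> In B l -> In (PImp B A) l -> fseq (A :: l).

Lemma fseq_cat l1 l2 : fseq l1 -> fseq l2 -> fseq (l1 ++ l2).
Proof.
elim=> [|A l _ IH ax|A B l _ IH i1 i2] f2 //=; first by apply: fseq_ax => //; apply: IH.
by apply: (fseq_mp (B := B)); [apply: IH|apply: In_catI; left|apply: In_catI; left].
Qed.

Lemma frege_axiom_sub s A : frege_axiom A -> frege_axiom (psub s A).
Proof. by case=> * /=; constructor. Qed.

(** Axioms are schemes, so one proof of a fixed tautology serves all its instances with the same
    number of lines. *)
Lemma fseq_sub s l : fseq l -> fseq (map (psub s) l).
Proof.
elim=> [|A l' _ IH ax|A B l' _ IH i1 i2] /=; first exact: fseq_nil.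
  by apply: fseq_ax => //; apply: frege_axiom_sub.
apply: (fseq_mp (B := psub s B)) => //; first exact: In_map_f.
exact: (In_map_f (psub s) i2).
Qed.

Lemma prv_fseq A : prv [::] A -> exists l, fseq (A :: l).
Proof.
elim=> // [B ax|B C _ [l1 f1] _ [l2 f2]].
  by exists [::]; apply: fseq_ax => //; apply: fseq_nil.
exists ((B :: l1) ++ (PImp B C :: l2)).
apply: (fseq_mp (B := B)); first exact: fseq_cat.
  by left.
by apply: In_catI; right; left.
Qed.

Lemma In_nth_rev (l : seq pform) A : In A l -> exists2 j, j < size l & nth PBot (rev l) j = A.
Proof.
elim: l => //= B l IH [->|/IH [j jl e]].
  by exists (size l) => //; rewrite rev_cons nth_rcons size_rev ltnn eqxx.
by exists j; [exact: leqW|rewrite rev_cons nth_rcons size_rev jl].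
Qed.

Lemma fseq_frege_proof A l : fseq (A :: l) -> frege_proof (rev (A :: l)) A.
Proof.
move=> f; split; first by rewrite rev_cons; case: (rev l).
split; first by rewrite rev_cons last_rcons.
have : forall l, fseq l -> forall i, i < size (rev l) ->
    frege_axiom (nth PBot (rev l) i) \/
    exists j k, [/\ j < i, k < i & nth PBot (rev l) k
                    = PImp (nth PBot (rev l) j) (nth PBot (rev l) i)].
  move=> {f}{}l; elim=> // [B {}l _ IH ax|B C {}l _ IH i1 i2] i.
    rewrite size_rev /= ltnS leq_eqVlt rev_cons nth_rcons size_rev => /orP[/eqP->|il].
      by rewrite ltnn eqxx; left.
    rewrite il; have [|?|[j [k [ji ki e]]]] := IH i; [by rewrite size_rev|by left|right].
    by exists j, k; split; rewrite // !nth_rcons size_rev (ltn_trans ji il) (ltn_trans ki il).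
  rewrite size_rev /= ltnS leq_eqVlt rev_cons nth_rcons size_rev => /orP[/eqP->|il].
    rewrite ltnn eqxx; right; have [j jl ej] := In_nth_rev i1; have [k kl ek] := In_nth_rev i2.
    by exists j, k; split; rewrite // !nth_rcons size_rev jl kl ej ek.
  rewrite il; have [|?|[j [k [ji ki e]]]] := IH i; [by rewrite size_rev|by left|right].
  by exists j, k; split; rewrite // !nth_rcons size_rev (ltn_trans ji il) (ltn_trans ki il).
exact.
Qed.

(** Only finitely many formulas are concerned, so their bounds have a common one. Induction on [n]
    replaces an enumeration: each top connective gets its own bound, and monotonicity allows adding
    them up. *)
Lemma bounded_choice k n (Phi : pform -> nat -> Prop) :
  (forall A c c', c <= c' -> Phi A c -> Phi A c') ->
  (forall A, exists c, Phi A c) ->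
  exists c, forall A, psize A <= n -> pbelow k A -> Phi A c.
Proof.
elim: n Phi => [|n IH] Phi mono ex; first by exists 0; case.
(* The induction hypothesis is used twice, for the right argument with [B] fixed and then for [B];
   this is why [Phi] is arbitrary. *)
have bin (K : pform -> pform -> pform) :
    exists c, forall B C, psize B <= n -> pbelow k B -> psize C <= n -> pbelow k C ->
    Phi (K B C) c.
  have [||c hc] := IH (fun B c => forall C, psize C <= n -> pbelow k C -> Phi (K B C) c).
  - by move=> B c c' cc' h C sC bC; apply: mono _ _ _ cc' (h C sC bC).
  - move=> B; apply: IH => [C c c'|C]; [exact: mono|exact: ex].
  - by exists c => B C sB bB; apply: hc.
have [c1 h1] : exists c, forall i, i < k -> Phi (PVar i) c.
  elim: {+}k => [|j [c hc]]; first by exists 0.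
  have [c' hc'] := ex (PVar j); exists (maxn c c') => i.
  rewrite ltnS leq_eqVlt => /orP[/eqP->|/hc]; first exact: mono _ _ _ (leq_maxr _ _) hc'.
  exact: mono _ _ _ (leq_maxl _ _).
have [c2 h2] := ex PBot.
have [||c3 h3] := IH (fun B => Phi (PNot B)).
- by move=> B c c'; apply: mono.
- by move=> B; apply: ex.
have [c4 h4] := bin PAnd; have [c5 h5] := bin POr; have [c6 h6] := bin PImp.
exists (c1 + c2 + c3 + c4 + c5 + c6) => -[i||B|B C|B C|B C] /=.
- by move=> _ ik; apply: (mono _ c1); [lia|apply: h1].
- by move=> _ _; apply: (mono _ c2); [lia|].
- by move=> sB bB; apply: (mono _ c3); [lia|apply: h3].
- by move=> sBC /andP[bB bC]; apply: (mono _ c4); [lia|apply: h4 => //; lia].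
- by move=> sBC /andP[bB bC]; apply: (mono _ c5); [lia|apply: h5 => //; lia].
- by move=> sBC /andP[bB bC]; apply: (mono _ c6); [lia|apply: h6 => //; lia].
Qed.

Definition bounded (l : seq pform) (m : nat) : Prop := forall A, In A l -> psize A <= m.

Lemma seq_bounded (l : seq pform) : exists m, bounded l m.
Proof.
elim: l => [|A l [m hm]]; first by exists 0.
exists (psize A + m) => B [<-|/hm]; lia.
Qed.

Lemma taut_proof_bound k n : exists c, forall A, psize A <= n -> pbelow k A -> taut A ->
  exists l, [/\ fseq (A :: l), size l <= c & bounded (A :: l) c].
Proof.
apply: bounded_choice => [A c c' cc' h tA|A].
  have [l [f s b]] := h tA; exists l; split=> //; first exact: leq_trans s cc'.
  by move=> B /b; lia.
(* For a formula that is no tautology the claim is vacuous and any bound does. *)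
have [tA|ntA] := classic (taut A); last by exists 0.
have [l f] := prv_fseq (prv_taut tA).
have [m hm] := seq_bounded (A :: l).
exists (size l + m) => _; exists l; split=> //; first lia.
by move=> B /hm; lia.
Qed.

Lemma psize_gt0 A : 0 < psize A.
Proof. by case: A. Qed.

Lemma psize_sub s A m : (forall i, psize (s i) <= m) -> psize (psub s A) <= psize A * m.
Proof.
move=> h; have := h 0; have := psize_gt0 (s 0).
elim: A => [i|||||] /=; [have := h i|..]; nia.
Qed.

Lemma bounded_map s l c m : (forall i, psize (s i) <= m) -> bounded l c ->
  bounded (map (psub s) l) (c * m).
Proof.
move=> hs hl A iA; have [B [<- iB]] := In_map iA.
have := psize_sub B hs; have := hl _ iB; nia.
Qed.

Lemma bounded_cat l l' m : bounded l m -> bounded l' m -> bounded (l ++ l') m.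
Proof. by move=> h h' A iA; have [/h|/h'] := In_catE iA. Qed.

Lemma bounded_le l m m' : bounded l m -> m <= m' -> bounded l m'.
Proof. by move=> h mm' A /h hA; apply: leq_trans mm'. Qed.

(* A derivation rule: the instance [sl] of a tautological inference [Ps |- T] whose validity is
   decided by computation.  Variable 19 is reserved for the hypothesis under which all lines of a
   chain are asserted. *)
Fixpoint all_bits (n : nat) (P : seq bool -> bool) : bool :=
  if n is n'.+1
  then all_bits n' (fun s => P (true :: s)) && all_bits n' (fun s => P (false :: s))
  else P [::].

(** Each premise and the conclusion are guarded separately, so modus ponens acts directly on lines
    [PImp H A] and no deduction theorem has to transform a proof. *)
Definition under_hyp (Ps : seq pform) (T : pform) : pform :=
  foldr PImp (PImp (PVar 19) T) [seq PImp (PVar 19) P | P <- Ps].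

(** The caps 19 and 3000 are generous; they place all guarded rules among the tautologies of size at
    most 3000 in 20 variables, whose proofs share one constant. *)
Definition valid_rule (n : nat) (Ps : seq pform) (T : pform) : bool :=
  [&& n <= 19, psize (under_hyp Ps T) <= 3000, all (pbelow n) (T :: Ps) &
      all_bits n (fun s => peval (nth false s) (foldr PImp T Ps))].

Definition rule (m : nat) (G : seq pform) (A : pform) : Prop :=
  exists Ps T sl, [/\ valid_rule (size sl) Ps T,
    (forall P, In P Ps -> In (psub (nth PBot sl) P) G),
    A = psub (nth PBot sl) T & bounded sl m].

Lemma all_bitsP n (P : seq bool -> bool) a : all_bits n P -> P (mkseq a n).
Proof.
elim: n P a => //= n IH P a /andP[h1 h2].
rewrite /mkseq /= -(addn0 1) iotaDl -map_comp.
by case: (a 0); [move: (IH _ (fun i => a i.+1) h1)|move: (IH _ (fun i => a i.+1) h2)].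
Qed.

Lemma eq_peval a b n A : (forall i, i < n -> a i = b i) -> pbelow n A -> peval a A = peval b A.
Proof.
move=> e; elim: A => //= [B IB|B IB C IC|B IB C IC|B IB C IC]; first by move/IB->.
all: by case/andP=> /IB-> /IC->.
Qed.

Lemma valid_rule_taut n Ps T : valid_rule n Ps T -> taut (under_hyp Ps T).
Proof.
case/and4P=> n19 _ bPT /all_bitsP h a; move: {h}(h a).
have {}bPT : pbelow n (foldr PImp T Ps).
  by move: bPT => /= /andP[bT]; elim: Ps => //= P Ps IH /andP[-> /IH].
rewrite (eq_peval (b := a) _ bPT) => [|i ik]; last by rewrite nth_mkseq.
have -> : peval a (under_hyp Ps T) = (a 19 ==> peval a (foldr PImp T Ps)).
  rewrite /under_hyp; elim: (Ps) => //= P Qs ->; by case: (a 19).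
by move->; rewrite implybT.
Qed.

Lemma valid_rule_below n Ps T : valid_rule n Ps T -> pbelow 20 (under_hyp Ps T).
Proof.
case/and4P=> n19 _ /= /andP[bT bP] _; have n20 : n <= 20 by lia.
rewrite /under_hyp; elim: Ps bP => [_|P Ps IH /= /andP[bP bPs]] /=.
  exact: pbelow_mono bT.
by rewrite IH // (pbelow_mono n20).
Qed.

(** Whole inferences count as single lines; line sizes follow from [m], since rule templates have
    bounded size. *)
Inductive chain (m : nat) (G : seq pform) : seq pform -> Prop :=
| chain_nil : chain m G [::]
| chain_cons A l : chain m G l -> rule m (l ++ G) A -> chain m G (A :: l).

Lemma fseq_mps (Qs : seq pform) B l : fseq l -> In (foldr PImp B Qs) l -> incl Qs l ->
  exists l', [/\ fseq (l' ++ l), size l' <= size Qs, In B (l' ++ l) &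
                 bounded l' (psize (foldr PImp B Qs))].
Proof.
elim: Qs l => [|Q Qs IH] l f /= i s; first by exists [::]; split=> // A [].
have f' : fseq (foldr PImp B Qs :: l).
  by apply: (fseq_mp (B := Q)) => //; apply: s; left.
have [||l' [f1 s1 i1 b1]] := IH _ f'; first by left.
  by move=> R iR; right; apply: s; right.
exists (l' ++ [:: foldr PImp B Qs]); rewrite -catA /=; split=> //.
  by rewrite size_cat /= addn1.
move=> R iR; have [/b1|[<-|[]]] := In_catE iR; lia.
Qed.

(** Each rule becomes an instance of a proof of its guarded template, followed by one modus ponens
    per premise. A rule has at most 3000 premises, whence [c + 3005]. *)
Lemma chain_fseq : exists c, forall m H l, chain m [:: H] l -> psize H <= m -> 
  exists pf, [/\ fseq pf, size pf <= c * (size l).+1, bounded pf (c * m) &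
                 forall A, In A (l ++ [:: H]) -> In (PImp H A) pf].
Proof.
have [c hc] := taut_proof_bound 20 3000.
exists (c + 3005) => m H l ch sH; have H0 := psize_gt0 H.
elim: ch => {l} [|A l ch [pf [f s b i]] [Ps [T [sl [vr iPs -> bsl]]]]].
  have [l [f s b]] : exists l, [/\ fseq (PImp (PVar 0) (PVar 0) :: l), size l <= c & bounded (PImp (PVar 0) (PVar 0) :: l) c].
    by apply: hc => // a; rewrite /= implybb.
  exists (map (psub (fun _ => H)) (PImp (PVar 0) (PVar 0) :: l)); split.
  - exact: fseq_sub.
  - by rewrite size_map /=; lia.
  - move=> D iD; have : psize D <= c * m; last nia.
    exact: (bounded_map (fun _ => sH) b).
  - by move=> A [<-|[]]; left.
(* Template variables lie below [size sl], which is at most 19, so the slot of the hypothesis cannot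
   clash with them. *)
set s19 := fun i => if i == 19 then H else nth PBot sl i.
have sz i' : psize (s19 i') <= m.
  rewrite /s19; case: ifP => // _; elim: (sl) bsl i' => [|B r IH] bB [|j] /=; try lia.
    by apply: bB; left.
  by apply: IH => C iC; apply: bB; right.
have eq19 B : pbelow (size sl) B -> psub s19 B = psub (nth PBot sl) B.
  have n19 : size sl <= 19 by case/and4P: vr.
  elim: B => //= [j|B IB|B IB C IC|B IB C IC|B IB C IC]; first 2 last.
  - by case/andP=> /IB-> /IC->.
  - by case/andP=> /IB-> /IC->.
  - by case/andP=> /IB-> /IC->.
  - by rewrite /s19; case: eqP => //; lia.
  - by move/IB->.
case/and4P: (vr) => n19 s3000 /= /andP[bT bPs] _.
have [l0 [f0 s0 b0]] := hc _ s3000 (valid_rule_below vr) (valid_rule_taut vr).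
have f1 := fseq_cat (fseq_sub s19 f0) f.
set Qs := [seq PImp H (psub (nth PBot sl) P) | P <- Ps].
have eU : psub s19 (under_hyp Ps T) = foldr PImp (PImp H (psub (nth PBot sl) T)) Qs.
  rewrite /under_hyp /Qs; elim: (Ps) bPs => [_|P Rs IH /= /andP[bP bR]] /=.
    by rewrite eq19.
  by rewrite eq19 // IH.
have sQs : size Qs <= 3000.
  apply: leq_trans s3000; rewrite /Qs /under_hyp; elim: (Ps) => //= P Rs; lia.
have [||l1 [f2 s2 i2 b2]] := fseq_mps (Qs := Qs) (B := PImp H (psub (nth PBot sl) T)) f1.
- by rewrite -eU; left.
- move=> Q iQ; have [P [<- iP]] := In_map iQ.
  by apply: In_catI; right; apply: i; apply: iPs.
exists (l1 ++ (map (psub s19) (under_hyp Ps T :: l0) ++ pf)); split=> //.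
- by move: s; rewrite !size_cat /= size_map; nia.
- apply: bounded_cat; first by apply: (bounded_le b2); rewrite -eU; apply: leq_trans (psize_sub _ sz) _; nia.
  apply: bounded_cat; first by apply: (bounded_le (bounded_map sz b0)); nia.
  exact: b.
move=> B [<- //|iB]; apply: In_catI; right; apply: In_catI; right; exact: i.
Qed.

Lemma proof_size_bound l k : bounded l k -> proof_size (rev l) <= size l * k.
Proof.
rewrite /proof_size; elim: l => [|B r IH] bB; first by rewrite big_nil.
rewrite rev_cons -cats1 big_cat big_seq1 /= mulSn addnC; apply: leq_add; first by apply: bB; left.
by apply: IH => D iD; apply: bB; right.
Qed.

(** The chain yields [PImp H PBot]; an instance of one fixed tautology turns this into [PNot H]. *)
Lemma chain_frege : exists c, forall m H l, chain m [:: H] l -> psize H <= m ->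
  In PBot (l ++ [:: H]) ->
  exists pf, frege_proof pf (PNot H) /\ proof_size pf <= c * (size l).+1 * m.
Proof.
have [c hc] := chain_fseq.
pose neg := PImp (PImp (PVar 0) PBot) (PNot (PVar 0)).
have [|l0 f0] := @prv_fseq neg.
  by apply: prv_taut => a /=; case: (a 0).
have [c0 b0] := seq_bounded (neg :: l0).
exists (((c + size l0 + 2)) * (c + c0 + 2)) => m H l ch sH iB; have H0 := psize_gt0 H.
have [pf [f s b i]] := hc _ _ _ ch sH.
pose pf' := PNot H :: map (psub (fun _ => H)) (neg :: l0) ++ pf.
have f' : fseq pf'.
  apply: (fseq_mp (B := PImp H PBot)).
  - exact: fseq_cat (fseq_sub _ f0) f.
  - by apply: In_catI; right; apply: i.
  - by left.
exists (rev pf'); split; first exact: fseq_frege_proof.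
have bm : bounded (map (psub (fun _ => H)) (neg :: l0) ++ pf) ((c + c0) * m).
  apply: bounded_cat.
    by apply: (bounded_le (bounded_map (fun _ => sH) b0)); rewrite leq_mul2r leq_addl orbT.
  by apply: (bounded_le b); rewrite leq_mul2r leq_addr orbT.
have bpf : bounded pf' ((c + c0 + 2) * m).
  by move=> B [<-|/bm]; rewrite !mulnDl /=; lia.
have spf : size pf' <= (c + size l0 + 2) * (size l).+1.
  by rewrite /= size_cat size_map; nia.
have := proof_size_bound bpf; nia.
Qed.

(** * Derivations with a bounded number of lines *)

(** The conclusion is a list so that lines shared by several consequences are counted once. *)
Definition prf (m : nat) (G : seq pform) (n : nat) (D : seq pform) : Prop :=
  exists l, [/\ chain m G l, size l <= n & incl D (l ++ G)].

Lemma rule_incl m G G' A : incl G G' -> rule m G A -> rule m G' A.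
Proof. by move=> s [Ps [T [sl [v i e b]]]]; exists Ps, T, sl; split=> // P /i/s. Qed.

Lemma incl_cat2 (T : Type) (l1 l1' l2 l2' : seq T) :
  incl l1 l1' -> incl l2 l2' -> incl (l1 ++ l2) (l1' ++ l2').
Proof. by move=> s1 s2 x /(@In_catE _ _ _ _)[/s1|/s2] i; apply: In_catI; [left|right]. Qed.

Lemma chain_incl m G G' l : incl G G' -> chain m G l -> chain m G' l.
Proof.
move=> s; elim=> [|A {}l _ IH r]; first exact: chain_nil.
by apply: chain_cons IH _; apply: rule_incl r; apply: incl_cat2.
Qed.

Lemma chain_cat m G l1 l2 : chain m G l1 -> chain m (l1 ++ G) l2 -> chain m G (l2 ++ l1).
Proof.
move=> c1; elim=> [|A l _ IH r] //=; apply: chain_cons IH _.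
by rewrite -catA.
Qed.

Lemma prf_weaken m G G' n n' D D' :
  prf m G n D -> incl G G' -> n <= n' -> incl D' D -> prf m G' n' D'.
Proof.
move=> [l [c s i]] sG nn' sD; exists l; split; [exact: chain_incl c|exact: leq_trans nn'|].
by move=> A /sD/i/(@In_catE _ _ _ _)[]iA; apply: In_catI; [left|right; apply: sG].
Qed.

Lemma prf_le m G n n' D : prf m G n D -> n <= n' -> prf m G n' D.
Proof. by move=> h nn'; apply: prf_weaken h _ nn' _. Qed.

Lemma prf_incl m G n D : incl D G -> prf m G n D.
Proof. by move=> s; exists [::]; split=> //; apply: chain_nil. Qed.

Lemma prf_hyp m G n A : In A G -> prf m G n [:: A].
Proof. by move=> iA; apply: prf_incl => B [<-|[]]. Qed.

Lemma prf_cut m G n1 n2 D1 D2 : prf m G n1 D1 -> prf m (D1 ++ G) n2 D2 ->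
  prf m G (n1 + n2) (D2 ++ D1).
Proof.
move=> [l1 [c1 s1 i1]] [l2 [c2 s2 i2]]; exists (l2 ++ l1); split.
- apply: chain_cat => //; apply: chain_incl c2.
  by move=> A /(@In_catE _ _ _ _)[/i1//|iA]; apply: In_catI; right.
- by rewrite size_cat; lia.
- rewrite -catA => A iA; apply: In_catI.
  have [iA2|iA1] := In_catE iA; last by right; apply: i1.
  have [|iA1] := In_catE (i2 _ iA2); [by left|right].
  have [/i1 //|iG] := In_catE iA1; by apply: In_catI; right.
Qed.

Lemma prf_cut1 m G n1 n2 n D1 D2 : prf m G n1 D1 -> prf m (D1 ++ G) n2 D2 -> n1 + n2 <= n ->
  prf m G n D2.
Proof.
move=> h1 h2 le; apply: (prf_weaken (prf_cut h1 h2)) => //.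
by move=> A iA; apply: In_catI; left.
Qed.

Lemma prf_cat m G n1 n2 D1 D2 : prf m G n1 D1 -> prf m G n2 D2 -> prf m G (n1 + n2) (D1 ++ D2).
Proof.
move=> h1 h2; have h2' : prf m (D1 ++ G) n2 D2.
  by apply: (prf_weaken h2) => // A iA; apply: In_catI; right.
by apply: (prf_weaken (prf_cut h1 h2')) => // A /(@In_catE _ _ _ _)[]iA; apply: In_catI; [right|left].
Qed.

Lemma prf_rule m G n D (Ps : seq pform) T sl :
  prf m G n D -> map (psub (nth PBot sl)) Ps = D ->
  valid_rule (size sl) Ps T -> all (fun A => psize A <= m) sl ->
  prf m G n.+1 [:: psub (nth PBot sl) T].
Proof.
move=> [l [c s i]] eD v b; exists (psub (nth PBot sl) T :: l); split=> //.
  apply: chain_cons => //; exists Ps, T, sl; split=> //.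
    by move=> P iP; apply: i; rewrite -eD; apply: In_map_f.
  by move=> A; elim: (sl) b => //= B r IH /andP[bB br] [<- //|]; apply: IH.
by move=> A [<-|[]]; left.
Qed.

Lemma prf_rule0 T sl m G n : valid_rule (size sl) [::] T -> all (fun A => psize A <= m) sl ->
  0 < n -> prf m G n [:: psub (nth PBot sl) T].
Proof.
move=> v b n0; apply: (@prf_le _ _ 1) => //.
have h : prf m G 0 [::] by apply: prf_incl => A [].
exact: (prf_rule h (Ps := [::])).
Qed.

Lemma prf_rule1 P1 T sl m G n n1 : valid_rule (size sl) [:: P1] T ->
  all (fun A => psize A <= m) sl -> n1 < n ->
  prf m G n1 [:: psub (nth PBot sl) P1] -> prf m G n [:: psub (nth PBot sl) T].
Proof.
by move=> v b n0 h1; apply: prf_le n0; apply: (prf_rule h1 (Ps := [:: P1])).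
Qed.

Lemma prf_rule2 P1 P2 T sl m G n n1 n2 : valid_rule (size sl) [:: P1; P2] T ->
  all (fun A => psize A <= m) sl -> n1 + n2 < n ->
  prf m G n1 [:: psub (nth PBot sl) P1] -> prf m G n2 [:: psub (nth PBot sl) P2] ->
  prf m G n [:: psub (nth PBot sl) T].
Proof.
move=> v b n0 h1 h2; apply: prf_le n0.
by apply: (prf_rule (prf_cat h1 h2) (Ps := [:: P1; P2])).
Qed.

Lemma prf_rule3 P1 P2 P3 T sl m G n n1 n2 n3 : valid_rule (size sl) [:: P1; P2; P3] T ->
  all (fun A => psize A <= m) sl -> n1 + n2 + n3 < n ->
  prf m G n1 [:: psub (nth PBot sl) P1] -> prf m G n2 [:: psub (nth PBot sl) P2] ->
  prf m G n3 [:: psub (nth PBot sl) P3] ->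
  prf m G n [:: psub (nth PBot sl) T].
Proof.
move=> v b n0 h1 h2 h3; apply: prf_le n0.
by apply: (prf_rule (prf_cat (prf_cat h1 h2) h3) (Ps := [:: P1; P2; P3])).
Qed.

Lemma prf_rule4 P1 P2 P3 P4 T sl m G n n1 n2 n3 n4 :
  valid_rule (size sl) [:: P1; P2; P3; P4] T ->
  all (fun A => psize A <= m) sl -> n1 + n2 + n3 + n4 < n ->
  prf m G n1 [:: psub (nth PBot sl) P1] -> prf m G n2 [:: psub (nth PBot sl) P2] ->
  prf m G n3 [:: psub (nth PBot sl) P3] -> prf m G n4 [:: psub (nth PBot sl) P4] ->
  prf m G n [:: psub (nth PBot sl) T].
Proof.
move=> v b n0 h1 h2 h3 h4; apply: prf_le n0.
by apply: (prf_rule (prf_cat (prf_cat (prf_cat h1 h2) h3) h4) (Ps := [:: P1; P2; P3; P4])).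
Qed.

Lemma prf_rule5 P1 P2 P3 P4 P5 T sl m G n n1 n2 n3 n4 n5 :
  valid_rule (size sl) [:: P1; P2; P3; P4; P5] T ->
  all (fun A => psize A <= m) sl -> n1 + n2 + n3 + n4 + n5 < n ->
  prf m G n1 [:: psub (nth PBot sl) P1] -> prf m G n2 [:: psub (nth PBot sl) P2] ->
  prf m G n3 [:: psub (nth PBot sl) P3] -> prf m G n4 [:: psub (nth PBot sl) P4] ->
  prf m G n5 [:: psub (nth PBot sl) P5] -> prf m G n [:: psub (nth PBot sl) T].
Proof.
move=> v b n0 h1 h2 h3 h4 h5; apply: prf_le n0.
by apply: (prf_rule (prf_cat (prf_cat (prf_cat (prf_cat h1 h2) h3) h4) h5)
  (Ps := [:: P1; P2; P3; P4; P5])).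
Qed.

(** * Balanced exclusive or *)

Definition pxor A B := POr (PAnd A (PNot B)) (PAnd (PNot A) B).
Definition piff A B := PAnd (PImp A B) (PImp B A).
Local Notation x0 := (PVar 0).
Local Notation x1 := (PVar 1).
Local Notation x2 := (PVar 2).
Local Notation x3 := (PVar 3).
Local Notation x4 := (PVar 4).
Local Notation x5 := (PVar 5).

(** A complete tree with [2 ^ d] leaves, padded by [PBot]: all sums have the same shape, so
    identities between sums are derived leaf by leaf without reassociation. *)
Fixpoint bx (d : nat) (f : nat -> pform) : pform :=
  if d is e.+1 then pxor (bx e f) (bx e (fun i => f (2 ^ e + i))) else f 0.

(** [pxor] copies both arguments and adds five connectives; the shift by 2 absorbs these and makes
    the recursion homogeneous. *)
Lemma psize_bx d f t : (forall i, psize (f i) <= t) -> psize (bx d f) + 2 <= 4 ^ d * (t + 2).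
Proof.
elim: d f => [|d IH] f h /=; first by rewrite mul1n leq_add2r.
have := IH _ h; have := IH (fun i => f (2 ^ d + i)) (fun i => h _).
by rewrite expnS -mulnA; lia.
Qed.

Lemma psize_bx_le d f t m : 4 ^ d * (t + 2) <= m -> (forall i, psize (f i) <= t) ->
  psize (bx d f) <= m.
Proof. by move=> le /psize_bx h; have := h d; lia. Qed.

Lemma eq_bx d f g : (forall i, i < 2 ^ d -> f i = g i) -> bx d f = bx d g.
Proof.
elim: d f g => [|d IH] f g e /=; first by rewrite e.
rewrite (IH f g) => [|i id]; last by apply: e; rewrite expnS; lia.
rewrite (IH (fun i => f (2 ^ d + i)) (fun i => g (2 ^ d + i))) // => i id.
by apply: e; rewrite expnS; lia.
Qed.

Lemma bx_bound_le d t m : 4 ^ d.+1 * (t + 2) <= m -> 4 ^ d * (t + 2) <= m.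
Proof. by apply: leq_trans; rewrite leq_mul2r leq_exp2l // leqnSn orbT. Qed.

(** Each of the [2 ^ d - 1] inner nodes costs one line, the interchange of the two middle summands,
    and each leaf costs [k]. *)
Lemma bx_add m G k t d f g h :
  (forall i, psize (f i) <= t) -> (forall i, psize (g i) <= t) -> (forall i, psize (h i) <= t) ->
  4 ^ d * (t + 2) <= m ->
  (forall i, i < 2 ^ d -> prf m G k [:: piff (h i) (pxor (f i) (g i))]) ->
  prf m G (2 ^ d * k.+1).-1 [:: piff (bx d h) (pxor (bx d f) (bx d g))].
Proof.
elim: d f g h => [|d IH] f g h sf sg sh tm pw.
  by rewrite mul1n /=; apply: pw.
have tm' := bx_bound_le tm.
have sz f' : (forall i, psize (f' i) <= t) -> psize (bx d f') <= m by apply: psize_bx_le.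
apply: (prf_rule2 (P1 := piff x0 (pxor x1 x2)) (P2 := piff x3 (pxor x4 x5))
  (T := piff (pxor x0 x3) (pxor (pxor x1 x4) (pxor x2 x5)))
  (sl := [:: bx d h; bx d f; bx d g; bx d (fun i => h (2 ^ d + i));
         bx d (fun i => f (2 ^ d + i)); bx d (fun i => g (2 ^ d + i))])); first by [].
- by rewrite /= !sz.
- 2: apply: IH => // i id; apply: pw; rewrite expnS; lia.
- 2: apply: IH => // i id; apply: pw; rewrite expnS; lia.
rewrite expnS; have := expn_gt0 2 d; nia.
Qed.

Lemma bx_mul m G k t d f h u :
  (forall i, psize (f i) <= t) -> (forall i, psize (h i) <= t) -> psize u <= m ->
  4 ^ d * (t + 2) <= m ->
  (forall i, i < 2 ^ d -> prf m G k [:: piff (h i) (PAnd (f i) u)]) ->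
  prf m G (2 ^ d * k.+1).-1 [:: piff (bx d h) (PAnd (bx d f) u)].
Proof.
elim: d f h => [|d IH] f h sf sh su tm pw.
  by rewrite mul1n /=; apply: pw.
have tm' := bx_bound_le tm.
have sz f' : (forall i, psize (f' i) <= t) -> psize (bx d f') <= m by apply: psize_bx_le.
apply: (prf_rule2 (P1 := piff x0 (PAnd x1 x4)) (P2 := piff x2 (PAnd x3 x4))
  (T := piff (pxor x0 x2) (PAnd (pxor x1 x3) x4))
  (sl := [:: bx d h; bx d f; bx d (fun i => h (2 ^ d + i));
         bx d (fun i => f (2 ^ d + i)); u])); first by [].
- by rewrite /= !sz // su.
- 2: apply: IH => // i id; apply: pw; rewrite expnS; lia.
- 2: apply: IH => // i id; apply: pw; rewrite expnS; lia.
rewrite expnS; have := expn_gt0 2 d; nia.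
Qed.

Lemma bx_zero m G d f :
  4 ^ d * 3 <= m -> (forall i, i < 2 ^ d -> f i = PBot) ->
  prf m G (2 ^ d * 2).-1 [:: PNot (bx d f)].
Proof.
move=> tm f0; rewrite (@eq_bx _ _ (fun _ => PBot)) // {f f0}.
elim: d tm => [|d IH] tm; first by apply: (prf_rule0 (T := PNot PBot) (sl := [::])).
have tm' := bx_bound_le (t := 1) tm.
apply: (prf_rule2 (P1 := PNot x0) (P2 := PNot x0) (T := PNot (pxor x0 x0))
  (sl := [:: bx d (fun _ => PBot)])); first by [].
- by rewrite /= (psize_bx_le (t := 1)).
- 2: exact: IH.
- 2: exact: IH.
rewrite expnS; have := expn_gt0 2 d; nia.
Qed.

(** The derivation descends towards leaf [k]; at each node the other half is refuted by
    [bx_zero]. *)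
Lemma bx_single m G d k u f : 4 ^ d * (psize u + 2) <= m -> k < 2 ^ d ->
  (forall i, i < 2 ^ d -> f i = if i == k then u else PBot) ->
  prf m G (2 ^ d * 2) [:: piff (bx d f) u].
Proof.
have u0 := psize_gt0 u.
move=> tm kd e; rewrite (eq_bx e) {f e}.
elim: d k tm kd => [|d IH] k tm kd.
  have -> : k = 0 by lia.
  apply: (prf_rule0 (T := piff x0 x0) (sl := [:: u])) => //=; lia.
have tm' := bx_bound_le tm.
have um : psize u <= m by have := expn_gt0 4 d; nia.
set f := fun i => _; have sf i : psize (f i) <= psize u by rewrite /f; case: ifP.
have sz j : psize (bx d (fun i => f (j + i))) <= m by apply: psize_bx_le tm' _.
have sz0 : psize (bx d f) <= m by apply: psize_bx_le tm' _.
have le3 : 4 ^ d * 3 <= m by apply: leq_trans tm'; rewrite leq_mul2l; lia.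
case: (ltnP k (2 ^ d)) => kd'.
  apply: (prf_rule2 (P1 := piff x0 x2) (P2 := PNot x1) (T := piff (pxor x0 x1) x2)
    (sl := [:: bx d f; bx d (fun i => f (2 ^ d + i)); u])); first by [].
  - by rewrite /= sz0 sz um.
  - 2: exact: IH.
  - 2: by apply: bx_zero => // i id; rewrite /f; case: eqP => // ek; lia.
  rewrite expnS; have := expn_gt0 2 d; nia.
have h : prf m G (2 ^ d * 2) [:: piff (bx d (fun i => f (2 ^ d + i))) u].
  rewrite (@eq_bx _ _ (fun i => if i == k - 2 ^ d then u else PBot)).
    by apply: IH => //; move: kd; rewrite expnS; lia.
  by move=> i _; rewrite /f; do 2!case: eqP => //; lia.
apply: (prf_rule2 (P1 := PNot x0) (P2 := piff x1 x2) (T := piff (pxor x0 x1) x2)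
  (sl := [:: bx d f; bx d (fun i => f (2 ^ d + i)); u])); first by [].
- by rewrite /= sz0 sz um.
- 2: by apply: bx_zero => // i id; rewrite /f; case: eqP => // ek; lia.
- 2: exact: h.
rewrite expnS; have := expn_gt0 2 d; nia.
Qed.

(** * Booleanization of non-commutative formulas *)

Definition pconst (a : 'F_2) : pform := if a == 0%R then PBot else PNot PBot.

(* The summands obtained by expanding [F] along its heavy path only: each step multiplies all
   summands by the value of a lighter sibling, or adds that value as a new summand. *)
Fixpoint terms (d : nat) (F : ncf nat) : seq pform :=
  match F with
  | NVar i => [:: PVar i]
  | NConst a => [:: pconst a]
  | NAdd g h =>
      if ncf_size h <= ncf_size g then rcons (terms d g) (bx d (nth PBot (terms d h)))
      else rcons (terms d h) (bx d (nth PBot (terms d g)))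
  | NMul g h =>
      if ncf_size h <= ncf_size g then map (PAnd^~ (bx d (nth PBot (terms d h)))) (terms d g)
      else map (PAnd^~ (bx d (nth PBot (terms d g)))) (terms d h)
  end.

(** The tree sees only the first [2 ^ d] summands; a formula has no more summands than its size, so
    sizes are kept below [2 ^ d]. *)
Definition bval (d : nat) (F : ncf nat) : pform := bx d (nth PBot (terms d F)).

(** Recurrence for formulas of size below [2 ^ e]: a summand gathers at most one light value, with
    one connective, per step of the heavy path, hence at most [2 ^ d] of them, and the tree
    contributes [4 ^ d]. *)
Fixpoint vbound (d e : nat) : nat :=
  if e is e'.+1 then 4 ^ d * (2 ^ d * (vbound d e').+1 + 4) else 0.

Lemma ncf_size_gt0 V (F : ncf V) : 0 < ncf_size F.
Proof. by case: F. Qed.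

Lemma size_terms d F : size (terms d F) <= ncf_size F.
Proof.
elim: F => //= g IHg h IHh; have := ncf_size_gt0 g; have := ncf_size_gt0 h.
all: by case: ifP => _; rewrite ?size_rcons ?size_map; lia.
Qed.

Lemma psize_nth l b i : 0 < b -> bounded l b -> psize (nth PBot l i) <= b.
Proof.
move=> b0; elim: l i => [|A l IH] [|i] h //=; first by apply: h; left.
by apply: IH => B iB; apply: h; right.
Qed.

Lemma bounded_rcons l A m : bounded l m -> psize A <= m -> bounded (rcons l A) m.
Proof.
rewrite -cats1 => h hA; apply: bounded_cat => // B [<-|[]] //.
Qed.

Lemma bounded_map_and l A m m' : bounded l m -> (m + psize A).+1 <= m' ->
  bounded (map (PAnd^~ A) l) m'.
Proof.
move=> h hA B iB; have [D [<- iD]] := In_map iB.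
by apply: leq_trans hA; rewrite /= ltnS leq_add2r; apply: h.
Qed.

Lemma psize_bval d e F : ncf_size F < 2 ^ e -> ncf_size F <= 2 ^ d -> psize (bval d F) <= vbound d e.
Proof.
elim: e F => [|e IH] F; first by have := ncf_size_gt0 F; rewrite expn0; lia.
move=> Fe Fd.
(* A light sibling has size below [2 ^ e], so the induction on [e] covers it, while the inner
   induction on [F] follows the heavy child at fixed [e]. *)
have light (g h : ncf nat) : ncf_size h <= ncf_size g -> (ncf_size g + ncf_size h).+1 < 2 ^ e.+1 ->
    (ncf_size g + ncf_size h).+1 <= 2 ^ d -> psize (bval d h) <= vbound d e.
  by rewrite expnS => *; apply: IH; lia.
have bt : bounded (terms d F) (2 + ncf_size F * (vbound d e).+1).
  elim: F Fe Fd => [i|a|g IHg h IHh|g IHg h IHh] /= Fe Fd.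
  - by move=> A [<-|[]].
  - by move=> A [<-|[]] //; rewrite /pconst; case: ifP.
  - case: (leqP (ncf_size h) (ncf_size g)) => gh.
      have lh := light g h gh Fe Fd.
      have {}IHg := IHg ltac:(lia) ltac:(lia).
      apply: bounded_rcons; first by apply: (bounded_le IHg); nia.
      by rewrite -/(bval d h); nia.
    have lg : psize (bval d g) <= vbound d e by apply: (light h g); lia.
    have {}IHh := IHh ltac:(lia) ltac:(lia).
    apply: bounded_rcons; first by apply: (bounded_le IHh); nia.
    by rewrite -/(bval d g); nia.
  - case: (leqP (ncf_size h) (ncf_size g)) => gh.
      have lh := light g h gh Fe Fd.
      have {}IHg := IHg ltac:(lia) ltac:(lia).
      by apply: (bounded_map_and IHg); rewrite -/(bval d h); have := ncf_size_gt0 h; nia.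
    have lg : psize (bval d g) <= vbound d e by apply: (light h g); lia.
    have {}IHh := IHh ltac:(lia) ltac:(lia).
    by apply: (bounded_map_and IHh); rewrite -/(bval d g); have := ncf_size_gt0 g; nia.
have : psize (bval d F) + 2 <= 4 ^ d * (2 + ncf_size F * (vbound d e).+1 + 2).
  by apply: psize_bx => i; apply: psize_nth.
move=> h; apply: leq_trans (leq_trans (leq_addr 2 _) h) _.
by rewrite /= leq_mul2l; apply/orP; right; nia.
Qed.

(** The 2 makes room for the leaves [PBot] and [PNot PBot]. *)
Definition vsize (d : nat) : nat := vbound d d + 2.
(** Bounds a tree whose leaves are themselves values, as in [lform]; it is the parameter [m] of all
    derivations about values. *)
Definition msize (d : nat) : nat := 4 ^ d * (vsize d + 2).

Lemma psize_bval_le d F : ncf_size F < 2 ^ d -> psize (bval d F) <= vsize d.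
Proof.
by move=> h; apply: leq_trans (leq_addr _ _); apply: psize_bval => //; apply: ltnW.
Qed.

Lemma vsize_msize d : vsize d <= msize d.
Proof. by rewrite /msize; have := expn_gt0 4 d; nia. Qed.

Lemma psize_bval_m d F : ncf_size F < 2 ^ d -> psize (bval d F) <= msize d.
Proof. by move=> h; apply: leq_trans (vsize_msize d); apply: psize_bval_le. Qed.

Lemma psize_terms d g i : ncf_size g < 2 ^ d -> psize (nth PBot (terms d g) i) <= vsize d.
Proof.
(* a summand of [g] is a subformula of the value of [g] *)
have sub e f j : j < 2 ^ e -> psize (f j) <= psize (bx e f).
  elim: e f j => [|e IH] f j; first by rewrite expn0 => j1; have -> : j = 0 by lia.
  rewrite expnS => je /=; case: (ltnP j (2 ^ e)) => [/(IH f)|jge]; first lia.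
  have := IH (fun i => f (2 ^ e + i)) (j - 2 ^ e) ltac:(lia); rewrite subnKC //; lia.
move=> gh; case: (ltnP i (2 ^ d)) => [/(sub _ (nth PBot (terms d g)))|id].
  by move=> le; apply: leq_trans le _; apply: psize_bval_le; lia.
rewrite nth_default; first by rewrite /vsize /=; lia.
by have := size_terms d g; lia.
Qed.

Lemma prf_leaf d G F t : terms d F = [:: t] -> psize t <= vsize d ->
  prf (msize d) G (2 ^ d * 2) [:: piff (bval d F) t].
Proof.
move=> e st; rewrite /bval e.
apply: (@bx_single _ _ _ 0) => [||i _]; last by case: i => [|[]].
  by rewrite leq_mul2l leq_add2r st orbT.
by rewrite expn_gt0.
Qed.

Lemma prf_var d G i : prf (msize d) G (2 ^ d * 2) [:: piff (bval d (NVar i)) (PVar i)].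
Proof. by apply: prf_leaf => //=; rewrite /vsize; lia. Qed.

Lemma prf_const d G a : prf (msize d) G (2 ^ d * 2) [:: piff (bval d (NConst a)) (pconst a)].
Proof. by apply: prf_leaf => //=; rewrite /vsize /pconst; case: ifP => _ /=; lia. Qed.

(** The appended summand is viewed as a tree of its own, with one nonzero leaf at the first free
    position, and added leafwise. The strict size bound guarantees that a leaf is free. *)
Lemma prf_rcons d G g h : (ncf_size g + ncf_size h).+1 < 2 ^ d ->
  prf (msize d) G (2 ^ d * 4)
    [:: piff (bx d (nth PBot (rcons (terms d g) (bval d h)))) (pxor (bval d g) (bval d h))].
Proof.
move=> gh.
have sh : psize (bval d h) <= vsize d by apply: psize_bval_le; lia.
have v0 : 0 < vsize d by rewrite /vsize; lia.
have d0 := expn_gt0 2 d.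
pose s i := if i == size (terms d g) then bval d h else PBot.
have ss i : psize (s i) <= vsize d by rewrite /s; case: ifP.
have st i : psize (nth PBot (terms d g) i) <= vsize d by apply: psize_terms; lia.
have sr i : psize (nth PBot (rcons (terms d g) (bval d h)) i) <= vsize d.
  by rewrite nth_rcons; case: ifP => _ //; case: ifP.
have szt : size (terms d g) < 2 ^ d by have := size_terms d g; lia.
have tv : 4 ^ d * (vsize d + 2) <= msize d by [].
have sm := vsize_msize d.
have m0 : 0 < msize d by lia.
have h1 : prf (msize d) G (2 ^ d * 2).-1
    [:: piff (bx d (nth PBot (rcons (terms d g) (bval d h))))
          (pxor (bx d (nth PBot (terms d g))) (bx d s))].
  apply: (bx_add (t := vsize d)) => // i id; rewrite nth_rcons /s.
  case: (ltngtP i (size (terms d g))) => ig.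
  - apply: (prf_rule0 (T := piff x0 (pxor x0 PBot)) (sl := [:: nth PBot (terms d g) i])) => //.
    by rewrite /= (leq_trans (st i)).
  - rewrite nth_default; last exact: ltnW.
    by apply: (prf_rule0 (T := piff PBot (pxor PBot PBot)) (sl := [::])).
  - rewrite nth_default; last by rewrite ig.
    apply: (prf_rule0 (T := piff x0 (pxor PBot x0)) (sl := [:: bval d h])) => //.
    by rewrite /= (leq_trans sh).
have h2 : prf (msize d) G (2 ^ d * 2) [:: piff (bx d s) (bval d h)].
  apply: (@bx_single _ _ _ (size (terms d g))) => //.
  by rewrite leq_mul2l leq_add2r sh orbT.
apply: (prf_rule2 (P1 := piff x0 (pxor x1 x2)) (P2 := piff x2 x3) (T := piff x0 (pxor x1 x3))
  (sl := [:: bx d (nth PBot (rcons (terms d g) (bval d h))); bx d (nth PBot (terms d g));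
   bx d s; bval d h])) => //.
- by rewrite /= (psize_bx_le tv sr) (psize_bx_le tv st) (psize_bx_le tv ss) (leq_trans sh sm).
- 2: exact: h1.
- 2: exact: h2.
lia.
Qed.

(** Values forget the order of operands: if the right one is heavier, one use of commutativity
    restores it. *)
Lemma prf_add d G g h : (ncf_size g + ncf_size h).+1 < 2 ^ d ->
  prf (msize d) G (2 ^ d * 5) [:: piff (bval d (NAdd g h)) (pxor (bval d g) (bval d h))].
Proof.
move=> gh; have d0 := expn_gt0 2 d; rewrite [bval d (NAdd g h)]/bval /=; case: ifP => _.
  by apply: prf_le (prf_rcons _ gh) _; lia.
rewrite addnC in gh.
have sz F : ncf_size F <= ncf_size h + ncf_size g -> psize (bval d F) <= msize d.
  by move=> le; apply: psize_bval_m; lia.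
apply: (prf_rule1 (P1 := piff x0 (pxor x2 x1)) (T := piff x0 (pxor x1 x2))
  (sl := [:: bx d (nth PBot (rcons (terms d h) (bval d g))); bval d g; bval d h])).
4: exact: (prf_rcons _ gh).
- by [].
- rewrite /= !sz ?leq_addr ?leq_addl //= !andbT.
  apply: (psize_bx_le (t := vsize d)) => // i; rewrite nth_rcons; case: ifP => _.
    by apply: psize_terms; lia.
  case: ifP => _; last by rewrite /vsize /=; lia.
  by apply: psize_bval_le; lia.
- lia.
Qed.

Lemma prf_map d G g h : (ncf_size g + ncf_size h).+1 < 2 ^ d ->
  (forall i, psize (nth PBot (map (PAnd^~ (bval d h)) (terms d g)) i) <= vsize d) ->
  prf (msize d) G (2 ^ d * 2)
    [:: piff (bx d (nth PBot (map (PAnd^~ (bval d h)) (terms d g)))) (PAnd (bval d g) (bval d h))].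
Proof.
move=> gh sr; have d0 := expn_gt0 2 d.
have sh : psize (bval d h) <= msize d by apply: psize_bval_m; lia.
have sm := vsize_msize d.
have st i : psize (nth PBot (terms d g) i) <= vsize d by apply: psize_terms; lia.
have h1 : prf (msize d) G (2 ^ d * 2).-1
    [:: piff (bx d (nth PBot (map (PAnd^~ (bval d h)) (terms d g))))
          (PAnd (bx d (nth PBot (terms d g))) (bval d h))].
  apply: (bx_mul (t := vsize d)) => // i id.
  case: (ltnP i (size (terms d g))) => ig.
    rewrite (nth_map PBot) //.
    apply: (prf_rule0 (T := piff (PAnd x0 x1) (PAnd x0 x1))
      (sl := [:: nth PBot (terms d g) i; bval d h])) => //.
    by rewrite /= (leq_trans (st i)) // sh.
  rewrite !nth_default ?size_map //.
  by apply: (prf_rule0 (T := piff PBot (PAnd PBot x0)) (sl := [:: bval d h])); rewrite //= sh.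
by apply: prf_le h1 _; lia.
Qed.

Lemma prf_mul d G g h : (ncf_size g + ncf_size h).+1 < 2 ^ d ->
  prf (msize d) G (2 ^ d * 3) [:: piff (bval d (NMul g h)) (PAnd (bval d g) (bval d h))].
Proof.
move=> gh; have d0 := expn_gt0 2 d.
have sr i : psize (nth PBot (terms d (NMul g h)) i) <= vsize d by apply: psize_terms.
move: sr; rewrite [bval d (NMul g h)]/bval /=; case: ifP => _ sr.
  by apply: prf_le (prf_map _ gh sr) _; lia.
rewrite addnC in gh.
have sz F : ncf_size F <= ncf_size h + ncf_size g -> psize (bval d F) <= msize d.
  by move=> le; apply: psize_bval_m; lia.
apply: (prf_rule1 (P1 := piff x0 (PAnd x2 x1)) (T := piff x0 (PAnd x1 x2))
  (sl := [:: bx d (nth PBot (map (PAnd^~ (bval d g)) (terms d h))); bval d g; bval d h])).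
4: exact: (prf_map _ gh sr).
- by [].
- by rewrite /= !sz ?leq_addr ?leq_addl //= !andbT; apply: (psize_bx_le (t := vsize d)).
- lia.
Qed.

Lemma F2P (a : 'F_2) : a = 0%R \/ a = 1%R.
Proof. by case: a => [[|[|//]] ?]; [left|right]; apply/val_inj. Qed.

Lemma F2_addxx (a : 'F_2) : (a + a = 0)%R.
Proof. by case: (F2P a) => ->; apply/val_inj. Qed.

(** * Linear combinations of generators *)

(** The product clause of [ncoef], freed from formulas: inductions on words must shift the left
    factor to [fun u => f (x :: u)], which need not come as a formula. *)
Definition conv (V : eqType) (f g : seq V -> 'F_2) (w : seq V) : 'F_2 :=
  (\sum_(i < (size w).+1) f (take i w) * g (drop i w))%R.

Lemma conv_nil (V : eqType) (f g : seq V -> 'F_2) : conv f g [::] = (f [::] * g [::])%R.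
Proof. by rewrite /conv big_ord1. Qed.

Lemma conv_cons (V : eqType) (f g : seq V -> 'F_2) x w :
  conv f g (x :: w) = (f [::] * g (x :: w) + conv (fun u => f (x :: u)) g w)%R.
Proof. by rewrite /conv /= big_ord_recl. Qed.

Lemma eq_conv (V : eqType) (f f' g g' : seq V -> 'F_2) :
  f =1 f' -> g =1 g' -> conv f g =1 conv f' g'.
Proof. by move=> ef eg w; apply: eq_bigr => i _; rewrite ef eg. Qed.

Lemma conv_affine (V : eqType) (c : 'F_2) (f f' g : seq V -> 'F_2) w :
  conv (fun u => c * f u + f' u)%R g w = (c * conv f g w + conv f' g w)%R.
Proof.
rewrite /conv mulr_sumr -big_split /=; apply: eq_bigr => i _.
by rewrite mulrDl mulrA.
Qed.

Lemma convA (V : eqType) (f g h : seq V -> 'F_2) w :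
  conv (conv f g) h w = conv f (conv g h) w.
Proof.
elim: w f => [|x w IH] f; first by rewrite !conv_nil mulrA.
(* Shifting [conv f g] by a letter gives a multiple of the shifted [g] plus the convolution of the
   shifted [f] with [g], to which the induction hypothesis applies. *)
have -> : conv (conv f g) h (x :: w) = (conv f g [::] * h (x :: w) +
    conv (fun u => f [::] * g (x :: u) + conv (fun u => f (x :: u)) g u) h w)%R.
  by rewrite conv_cons; congr (_ + _)%R; apply: eq_conv => // u; rewrite conv_cons.
rewrite !conv_cons.
by rewrite conv_affine IH conv_nil mulrDr addrA mulrA.
Qed.

Lemma ncoef_mulA (V : eqType) (f g h : ncf V) w :
  ncoef (NMul f (NMul g h)) w = ncoef (NMul (NMul f g) h) w.
Proof. by symmetry; apply: (convA (ncoef f) (ncoef g) (ncoef h)). Qed.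

Lemma ncoef_mulDr (V : eqType) (f g h : ncf V) w :
  ncoef (NMul f (NAdd g h)) w = (ncoef (NMul f g) w + ncoef (NMul f h) w)%R.
Proof. by rewrite /= -big_split /=; apply: eq_bigr => i _; rewrite mulrDr. Qed.

Lemma ncoef_mulc (V : eqType) (f : ncf V) a w :
  ncoef (NMul f (NConst a)) w = (ncoef f w * a)%R.
Proof.
rewrite /= big_ord_recr /= take_size drop_size eqxx big1 ?add0r // => i _.
case: eqP => [e|]; last by rewrite mulr0.
by have := congr1 size e; rewrite size_drop /=; have := ltn_ord i; lia.
Qed.

Lemma ncoef_cmul (V : eqType) (f : ncf V) a w :
  ncoef (NMul (NConst a) f) w = (a * ncoef f w)%R.
Proof.
rewrite /= big_ord_recl /= take0 drop0 big1 ?addr0 // => i _.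
by case: w i => [|x w] i //=; [case: i|rewrite mul0r].
Qed.

Lemma ncoef_mulx_nil (V : eqType) (f : ncf V) x : ncoef (NMul f (NVar x)) [::] = 0%R.
Proof. by rewrite /= big_ord1 /= mulr0. Qed.

(** Right division by a variable: only the split before the last letter contributes, so the
    coefficients of [f] can be read off those of the product. *)
Lemma ncoef_mulx_rcons (V : eqType) (f : ncf V) x u y :
  ncoef (NMul f (NVar x)) (rcons u y) = (ncoef f u * (y == x)%:R)%R.
Proof.
rewrite /= size_rcons !big_ord_recr /= -cats1 take_size_cat // drop_size_cat //.
rewrite take_oversize ?size_cat ?addn1 // drop_oversize ?size_cat ?addn1 // mulr0 addr0.
rewrite big1 => [|i _]; last first.
  case: eqP => [/(congr1 size)|_]; last by rewrite mulr0.
  by rewrite size_drop size_cat /=; have := ltn_ord i; lia.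
by rewrite add0r /eq_op /= andbT.
Qed.

(** * Coordinate vectors over the generators and their formulas *)

Definition vec := nat -> 'F_2.
Definition delta (k : nat) : vec := fun i => (i == k)%:R%R.

Definition lcoef (gen : nat -> ncf nat) (D : nat) (r : vec) (w : seq nat) : 'F_2 :=
  (\sum_(i < D) r i * ncoef (gen i) w)%R.

Lemma lcoef_delta gen D k w : k < D -> lcoef gen D (delta k) w = ncoef (gen k) w.
Proof.
move=> kD; rewrite /lcoef (bigD1 (Ordinal kD)) //= /delta eqxx mul1r big1 ?addr0 // => i ik.
by rewrite -val_eqE /= in ik; rewrite (negbTE ik) mul0r.
Qed.

Lemma lcoef_add gen D r1 r2 w :
  lcoef gen D (fun i => r1 i + r2 i)%R w = (lcoef gen D r1 w + lcoef gen D r2 w)%R.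
Proof. by rewrite /lcoef -big_split; apply: eq_bigr => i _; rewrite mulrDl. Qed.

Lemma lcoef_scale gen D r a w :
  lcoef gen D (fun i => r i * a)%R w = (lcoef gen D r w * a)%R.
Proof. by rewrite /lcoef mulr_suml; apply: eq_bigr => i _; rewrite mulrAC. Qed.

Definition lform (d : nat) (gen : nat -> ncf nat) (r : vec) : pform :=
  bx d (fun j => if r j == 0%R then PBot else bval d (gen j)).

Definition small_gens (d : nat) (gen : nat -> ncf nat) : Prop :=
  forall j, ncf_size (gen j) < 2 ^ d.

Lemma eq_lform d gen r r' : (forall i, i < 2 ^ d -> r i = r' i) -> lform d gen r = lform d gen r'.
Proof. by move=> e; apply: eq_bx => i id; rewrite e. Qed.

Lemma psize_lform_term d gen (r : vec) j : small_gens d gen ->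
  psize (if r j == 0%R then PBot else bval d (gen j)) <= vsize d.
Proof. by move=> s; case: ifP => _; [rewrite /vsize /=; lia|apply: psize_bval_le]. Qed.

Lemma psize_lform d gen r : small_gens d gen -> psize (lform d gen r) <= msize d.
Proof. by move=> s; apply: (psize_bx_le (t := vsize d)) => // i; apply: psize_lform_term. Qed.

Lemma prf_ladd d G gen r r1 r2 : small_gens d gen ->
  (forall i, i < 2 ^ d -> r i = (r1 i + r2 i)%R) ->
  prf (msize d) G (2 ^ d * 2)
    [:: piff (lform d gen r) (pxor (lform d gen r1) (lform d gen r2))].
Proof.
move=> s e; apply: (@prf_le _ _ (2 ^ d * 2).-1); last lia.
apply: (bx_add (t := vsize d)) => [i|i|i||i id]; try exact: psize_lform_term; first by [].
have sm : psize (bval d (gen i)) <= msize d by apply: psize_bval_m.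
rewrite (e i id); case: (F2P (r1 i)) => ->; case: (F2P (r2 i)) => ->;
  rewrite ?addr0 ?add0r ?F2_addxx ?eqxx ?oner_eq0 //.
- by apply: (prf_rule0 (T := piff PBot (pxor PBot PBot)) (sl := [::])).
- by apply: (prf_rule0 (T := piff x0 (pxor PBot x0)) (sl := [:: bval d (gen i)])) => //=; rewrite sm.
- by apply: (prf_rule0 (T := piff x0 (pxor x0 PBot)) (sl := [:: bval d (gen i)])) => //=; rewrite sm.
- by apply: (prf_rule0 (T := piff PBot (pxor x0 x0)) (sl := [:: bval d (gen i)])) => //=; rewrite sm.
Qed.

Lemma prf_ldelta d G gen k : small_gens d gen -> k < 2 ^ d ->
  prf (msize d) G (2 ^ d * 2) [:: piff (lform d gen (delta k)) (bval d (gen k))].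
Proof.
move=> s kd; apply: (@bx_single _ _ _ k) => // [|i _].
  by rewrite leq_mul2l leq_add2r psize_bval_le ?orbT.
by rewrite /delta; case: (i =P k) => [->|_]; rewrite ?eqxx ?oner_eq0.
Qed.

Lemma prf_lzero d G gen r : (forall i, i < 2 ^ d -> r i = 0%R) ->
  prf (msize d) G (2 ^ d * 2) [:: PNot (lform d gen r)].
Proof.
move=> e; apply: (@prf_le _ _ (2 ^ d * 2).-1); last lia.
apply: bx_zero => [|i id]; last by rewrite e // eqxx.
by rewrite leq_mul2l /vsize; lia.
Qed.

Lemma prf_lsum d G gen k (l : seq vec) r : small_gens d gen ->
  (forall b, In b l -> prf (msize d) G k [:: PNot (lform d gen b)]) ->
  (forall i, i < 2 ^ d -> r i = (\sum_(b <- l) b i)%R) ->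
  prf (msize d) G (size l * (k + 2 ^ d * 2).+1 + 2 ^ d * 2) [:: PNot (lform d gen r)].
Proof.
move=> s; elim: l r => [|b l IH] r h e.
  by apply: prf_le (prf_lzero _ _ _) _ => // i /e ->; rewrite big_nil.
pose r' := (fun i => \sum_(b <- l) b i)%R.
have hr' : prf (msize d) G (size l * (k + 2 ^ d * 2).+1 + 2 ^ d * 2) [:: PNot (lform d gen r')].
  by apply: IH => // c ic; apply: h; right.
apply: (prf_rule3 (P1 := piff x0 (pxor x1 x2)) (P2 := PNot x1) (P3 := PNot x2) (T := PNot x0)
  (sl := [:: lform d gen r; lform d gen b; lform d gen r'])); first by [].
- by rewrite /= !psize_lform.
- 2: by apply: prf_ladd => // i id; rewrite e // big_cons.
- 2: by apply: h; left.
- 2: exact: hr'.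
rewrite /=; nia.
Qed.

(* [gpre * x_gvar] is a new generator and [grow] expands [gpre] in the generators before it. *)
Record gstep := GStep { gpre : ncf nat; gvar : nat; grow : vec }.
Definition gdef : gstep := GStep (NConst 0%R) 0 (fun _ => 0%R).
Definition gform (t : gstep) : ncf nat := NMul (gpre t) (NVar (gvar t)).

Definition row_facts (d : nat) (gen : nat -> ncf nat) (G : seq gstep) : seq pform :=
  [seq piff (bval d (gpre t)) (lform d gen (grow t)) | t <- G].

Lemma nth_cat_add (T : Type) (x : T) (s1 s2 : seq T) j :
  nth x (s1 ++ s2) (size s1 + j) = nth x s2 j.
Proof. by rewrite nth_cat ltnNge leq_addr /= addKn. Qed.

Lemma prf_assoc d G f g h : ncf_size f + ncf_size g + ncf_size h + 2 < 2 ^ d ->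
  prf (msize d) G (2 ^ d * 13)
    [:: piff (bval d (NMul f (NMul g h))) (bval d (NMul (NMul f g) h))].
Proof.
move=> sz; have d0 := expn_gt0 2 d.
have := ncf_size_gt0 f; have := ncf_size_gt0 g; have := ncf_size_gt0 h => h0 g0 f0.
apply: (@prf_le _ _ (2 ^ d * 3 + 2 ^ d * 3 + 2 ^ d * 3 + 2 ^ d * 3).+1); last lia.
apply: (prf_rule4 (P1 := piff x0 (PAnd x4 x2)) (P2 := piff x2 (PAnd x5 (PVar 6)))
  (P3 := piff x1 (PAnd x3 (PVar 6))) (P4 := piff x3 (PAnd x4 x5)) (T := piff x0 x1)
  (sl := [:: bval d (NMul f (NMul g h)); bval d (NMul (NMul f g) h); bval d (NMul g h);
             bval d (NMul f g); bval d f; bval d g; bval d h])); first by [].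
- by rewrite /= !psize_bval_m //=; lia.
- exact: ltnSn.
- by apply: prf_mul => /=; lia.
- by apply: prf_mul => /=; lia.
- by apply: prf_mul => /=; lia.
- by apply: prf_mul => /=; lia.
Qed.

Lemma prf_distr d G f g h : ncf_size f + ncf_size g + ncf_size h + 2 < 2 ^ d ->
  prf (msize d) G (2 ^ d * 15)
    [:: piff (bval d (NMul f (NAdd g h))) (pxor (bval d (NMul f g)) (bval d (NMul f h)))].
Proof.
move=> sz; have d0 := expn_gt0 2 d.
have := ncf_size_gt0 f; have := ncf_size_gt0 g; have := ncf_size_gt0 h => h0 g0 f0.
apply: (@prf_le _ _ (2 ^ d * 3 + 2 ^ d * 5 + 2 ^ d * 3 + 2 ^ d * 3).+1); last lia.
apply: (prf_rule4 (P1 := piff x0 (PAnd x4 x2)) (P2 := piff x2 (pxor x5 (PVar 6)))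
  (P3 := piff x1 (PAnd x4 x5)) (P4 := piff x3 (PAnd x4 (PVar 6))) (T := piff x0 (pxor x1 x3))
  (sl := [:: bval d (NMul f (NAdd g h)); bval d (NMul f g); bval d (NAdd g h);
             bval d (NMul f h); bval d f; bval d g; bval d h])); first by [].
- by rewrite /= !psize_bval_m //=; lia.
- exact: ltnSn.
- by apply: prf_mul => /=; lia.
- by apply: prf_add => /=; lia.
- by apply: prf_mul => /=; lia.
- by apply: prf_mul => /=; lia.
Qed.

Definition spans (d : nat) (gen : nat -> ncf nat) (F : ncf nat) (r : vec) : Prop :=
  forall w, ncoef F w = lcoef gen (2 ^ d) r w.

(** [Q] is the prefix read so far, with coordinates [q] over the generators before [k]; reading [F]
    appends the generators [G]. The sequence [gen] is quantified after [G] and [r], since the full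
    list of generators is known only at the end; it has to agree with [G] on its own window of
    indices. *)
Lemma linearize F Q k (q : vec) : (forall i, k <= i -> q i = 0%R) ->
  exists (G : seq gstep) (r : vec),
    [/\ size G <= ncf_size F,
        (forall i, k + size G <= i -> r i = 0%R),
        (forall j, j < size G -> ncf_size (gpre (nth gdef G j)) <= ncf_size Q + ncf_size F),
        (forall j i, j < size G -> k + j <= i -> grow (nth gdef G j) i = 0%R) &
        forall d gen, small_gens d gen -> k + size G <= 2 ^ d ->
          ncf_size Q + ncf_size F + 2 < 2 ^ d ->
          (forall j, j < size G -> gen (k + j) = gform (nth gdef G j)) ->
          spans d gen Q q ->
          [/\ spans d gen (NMul Q F) r,
              (forall j, j < size G -> spans d gen (gpre (nth gdef G j)) (grow (nth gdef G j))) &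
              forall H, In (piff (bval d Q) (lform d gen q)) H ->
              prf (msize d) H (ncf_size F * (2 ^ d * 30))
                (piff (bval d (NMul Q F)) (lform d gen r) :: row_facts d gen G)]].
Proof.
elim: F Q k q => [x|a|g IHg h IHh|g IHg h IHh] Q k q q0.
(* A variable creates the generator [Q * x], and the coordinates of [Q] become its row. *)
- exists [:: GStep Q x q], (delta k); split=> //=.
  + by move=> i; rewrite /delta addn1 => ki; rewrite gtn_eqF.
  + by case=> // _; rewrite leq_addr.
  + by case=> // i _; rewrite addn0; apply: q0.
  move=> d gen s kd sz eg sQ; have := eg 0 isT; rewrite addn0 /= => ek.
  have kd' : k < 2 ^ d by lia.
  split=> //; first by move=> w; rewrite lcoef_delta // ek.
    by case=> // _; apply: sQ.
  move=> H iH; apply: (@prf_le _ _ (2 ^ d * 3 + 2 ^ d)); last by lia.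
  apply: (@prf_cat _ _ _ _ [:: _] [:: _]); last exact: prf_hyp.
  apply: (prf_rule1 (P1 := piff x0 x1) (T := piff x1 x0)
    (sl := [:: lform d gen (delta k); bval d (NMul Q (NVar x))])); first by [].
  + by rewrite /= psize_lform // psize_bval_m //=; move: sz => /=; lia.
  + 2: by have h := @prf_ldelta d H gen k s kd'; rewrite ek in h; exact: h.
  by have := expn_gt0 2 d; lia.
- exists [::], (fun i => q i * a)%R; split=> //=.
    by move=> i; rewrite addn0 => /q0 ->; rewrite mul0r.
  move=> d gen s kd sz _ sQ; split=> //.
    by move=> w; rewrite ncoef_mulc lcoef_scale sQ.
  move=> H iH; have d0 := expn_gt0 2 d.
  have sb : psize (bval d Q) <= msize d by apply: psize_bval_m; lia.
  have sa : psize (bval d (NConst a)) <= msize d by apply: psize_bval_m => /=; lia.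
  have sm : psize (bval d (NMul Q (NConst a))) <= msize d.
    by apply: psize_bval_m; move: sz => /=; lia.
  have pm : prf (msize d) H (2 ^ d * 3) [:: piff (bval d (NMul Q (NConst a)))
      (PAnd (bval d Q) (bval d (NConst a)))].
    by apply: prf_mul; move: sz => /=; lia.
  have pa := prf_const d H a.
  rewrite mul1n; case: (F2P a) => ea.
    apply: (@prf_le _ _ (2 ^ d * 3 + 2 ^ d * 2 + 2 ^ d * 2).+1); last by lia.
    rewrite ea /pconst eqxx in pa pm sa sm *.
    apply: (prf_rule3 (P1 := piff x0 (PAnd x1 x2)) (P2 := piff x2 PBot) (P3 := PNot x3)
      (T := piff x0 x3) (sl := [:: bval d (NMul Q (NConst 0%R)); bval d Q; bval d (NConst 0%R);
       lform d gen (fun i => q i * 0)%R])) => //.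
    + by rewrite /= sm sb sa psize_lform.
    + by apply: prf_lzero => i _; rewrite mulr0.
  apply: (@prf_le _ _ (2 ^ d * 3 + 2 ^ d * 2 + 0).+1); last by lia.
  rewrite ea /pconst oner_eq0 in pa pm sa sm *.
  rewrite (@eq_lform d gen _ q); last by move=> i _; rewrite mulr1.
  apply: (prf_rule3 (P1 := piff x0 (PAnd x1 x2)) (P2 := piff x2 (PNot PBot)) (P3 := piff x1 x3)
      (T := piff x0 x3) (sl := [:: bval d (NMul Q (NConst 1%R)); bval d Q; bval d (NConst 1%R);
       lform d gen q])) => //.
  + by rewrite /= sm sb sa psize_lform.
  + exact: prf_hyp.
(* Both summands are read after the same prefix [Q]; the second only has its new indices shifted. *)
- have [G1 [r1 [s1 z1 b1 t1 h1]]] := IHg Q k q q0.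
  have q1 i : k + size G1 <= i -> q i = 0%R by move=> le; apply: q0; lia.
  have [G2 [r2 [s2 z2 b2 t2 h2]]] := IHh Q (k + size G1) q q1.
  exists (G1 ++ G2), (fun i => r1 i + r2 i)%R; split.
  + by rewrite size_cat /=; lia.
  + by move=> i; rewrite size_cat addnA => le; rewrite z2 // z1 ?addr0 //; lia.
  + move=> j; rewrite size_cat nth_cat; case: (ltnP j (size G1)) => [/b1 /= b _|le jl]; first lia.
    by have := b2 (j - size G1) ltac:(lia); move=> /=; lia.
  + move=> j i; rewrite size_cat nth_cat; case: (ltnP j (size G1)) => [j1 _|le jl] ki; first exact: t1.
    by apply: t2; lia.
  move=> d gen s kd sz eg sQ; rewrite size_cat addnA /= in kd sz eg.
  have [||||e1 f1 p1] := h1 d gen s => //; try lia.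
    by move=> j j1; rewrite eg ?nth_cat ?j1 //; lia.
  have [||||e2 f2 p2] := h2 d gen s => //; try lia.
    by move=> j j2; rewrite -addnA eg ?nth_cat_add //; lia.
  split.
  + by move=> w; rewrite ncoef_mulDr e1 e2 lcoef_add.
  + move=> j; rewrite size_cat nth_cat; case: (ltnP j (size G1)) => [/f1 //|le jl].
    by apply: f2; lia.
  move=> H iH; have {}p1 := p1 H iH; have {}p2 := p2 H iH.
  have p12 := prf_cat p1 p2.
  have pD : prf (msize d) ((piff (bval d (NMul Q g)) (lform d gen r1) :: row_facts d gen G1) ++
     (piff (bval d (NMul Q h)) (lform d gen r2) :: row_facts d gen G2) ++ H) (2 ^ d * 30)
     [:: piff (bval d (NMul Q (NAdd g h))) (lform d gen (fun i => r1 i + r2 i)%R)].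
    apply: (@prf_le _ _ (2 ^ d * 15 + 2 ^ d * 2 + 0 + 0).+1).
      2: by have := expn_gt0 2 d; lia.
    apply: (prf_rule4 (P1 := piff x0 (pxor x1 x2)) (P2 := piff x3 (pxor x4 x5))
      (P3 := piff x1 x4) (P4 := piff x2 x5) (T := piff x0 x3)
      (sl := [:: bval d (NMul Q (NAdd g h)); bval d (NMul Q g); bval d (NMul Q h);
        lform d gen (fun i => r1 i + r2 i)%R; lform d gen r1; lform d gen r2])); first by [].
    + by rewrite /= !psize_lform // !psize_bval_m //=; lia.
    + exact: ltnSn.
    + by apply: prf_distr; lia.
    + exact: prf_ladd.
    + by apply: prf_hyp; left.
    + by apply: prf_hyp; apply: In_catI; right; left.
  rewrite catA in pD; have := prf_cut p12 pD.
  move=> hc; apply: (prf_weaken hc) => //=; first by lia.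
  rewrite /row_facts map_cat => A [<-|iA]; first by left.
  right; have [i|i] := In_catE iA; first by right; apply: In_catI; left.
  by right; apply: In_catI; right; right.
(* The right factor is read after the prefix [NMul Q g], whose coordinates are [r1]; associativity
   is restored at the end. *)
- have [G1 [r1 [s1 z1 b1 t1 h1]]] := IHg Q k q q0.
  have [G2 [r2 [s2 z2 b2 t2 h2]]] := IHh (NMul Q g) (k + size G1) r1 z1.
  exists (G1 ++ G2), r2; split.
  + by rewrite size_cat /=; lia.
  + by move=> i; rewrite size_cat addnA => le; rewrite z2.
  + move=> j; rewrite size_cat nth_cat; case: (ltnP j (size G1)) => [/b1 /= b _|le jl]; first lia.
    by have := b2 (j - size G1) ltac:(lia); move=> /=; lia.
  + move=> j i; rewrite size_cat nth_cat; case: (ltnP j (size G1)) => [j1 _|le jl] ki; first exact: t1.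
    by apply: t2; lia.
  move=> d gen s kd sz eg sQ; rewrite size_cat addnA /= in kd sz eg.
  have [||||e1 f1 p1] := h1 d gen s => //; try lia.
    by move=> j j1; rewrite eg ?nth_cat ?j1 //; lia.
  have [||||e2 f2 p2] := h2 d gen s => //=; try lia.
    by move=> j j2; rewrite -addnA eg ?nth_cat_add //; lia.
  split.
  + by move=> w; rewrite ncoef_mulA e2.
  + move=> j; rewrite size_cat nth_cat; case: (ltnP j (size G1)) => [/f1 //|le jl].
    by apply: f2; lia.
  move=> H iH; have {}p1 := p1 H iH.
  have {}p2 := p2 ((piff (bval d (NMul Q g)) (lform d gen r1) :: row_facts d gen G1) ++ H)
    (or_introl (erefl _)).
  have p12 := prf_cut p1 p2.
  have pD : prf (msize d) (((piff (bval d (NMul (NMul Q g) h)) (lform d gen r2)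
      :: row_facts d gen G2) ++
     (piff (bval d (NMul Q g)) (lform d gen r1) :: row_facts d gen G1)) ++ H) (2 ^ d * 30)
     [:: piff (bval d (NMul Q (NMul g h))) (lform d gen r2)].
    apply: (@prf_le _ _ (2 ^ d * 13 + 0).+1).
      2: by have := expn_gt0 2 d; lia.
    apply: (prf_rule2 (P1 := piff x0 x1) (P2 := piff x1 x2) (T := piff x0 x2)
      (sl := [:: bval d (NMul Q (NMul g h)); bval d (NMul (NMul Q g) h); lform d gen r2]));
      first by [].
    + by rewrite /= !psize_lform // !psize_bval_m //=; lia.
    + exact: ltnSn.
    + by apply: prf_assoc; lia.
    + by apply: prf_hyp; left.
  have := prf_cut p12 pD.
  move=> hc; apply: (prf_weaken hc) => //=; first by lia.
  rewrite /row_facts map_cat => A [<-|iA]; first by left.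
  right; right; have [i|i] := In_catE iA; apply: In_catI; [by right; right|by left].
Qed.

(** * Refuting relations among the generators *)

Record gen_system (d : nat) (gen : nat -> ncf nat) (G : seq gstep) : Prop := GenSystem {
  gs_small : small_gens d gen;
  gs_size : size G < 2 ^ d;
  gs_one : gen 0 = NConst 1%R;
  gs_step : forall j, j < size G -> gen j.+1 = gform (nth gdef G j);
  gs_span : forall j, j < size G ->
    spans d gen (gpre (nth gdef G j)) (grow (nth gdef G j));
  gs_row : forall j i, j < size G -> j < i -> grow (nth gdef G j) i = 0%R }.

Definition relation (d : nat) (gen : nat -> ncf nat) (r : vec) : Prop :=
  forall w, lcoef gen (2 ^ d) r w = 0%R.

(* Among the first [J] non-constant generators, the part of the combination [r] ending in [x]
   ([pvec]) and its right quotient by [x] ([prow]). *)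
Definition pvec (G : seq gstep) (r : vec) (x J : nat) : vec := fun i =>
  if i is j.+1 then if (gvar (nth gdef G j) == x) && (j < J) then r i else 0%R else 0%R.

Definition prow (G : seq gstep) (r : vec) (x J : nat) : vec := fun i =>
  (\sum_(j < J | gvar (nth gdef G j) == x) r j.+1 * grow (nth gdef G j) i)%R.

Lemma lcoef_gens d gen G (r : vec) J w : gen_system d gen G -> J <= size G ->
  (forall i, J < i -> r i = 0%R) ->
  lcoef gen (2 ^ d) r w = (r 0 * ncoef (NConst 1) w +
    \sum_(j < J) r j.+1 * ncoef (gform (nth gdef G j)) w)%R.
Proof.
move=> gs JG r0; rewrite /lcoef; have JD : J <= (2 ^ d).-1 by have := gs_size gs; lia.
have -> : 2 ^ d = (2 ^ d).-1.+1 by have := gs_size gs; lia.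
rewrite big_ord_recl (gs_one gs); congr (_ + _)%R.
rewrite (big_ord_widen _ (fun j => r j.+1 * ncoef (gform (nth gdef G j)) w)%R JD) [RHS]big_mkcond /=.
apply: eq_bigr => i _; rewrite /bump add1n; case: ifP => iJ; last by rewrite r0 ?mul0r //; lia.
by rewrite (gs_step gs) //; lia.
Qed.

(** At the empty word every generator ending in a variable vanishes, which isolates the constant
    one. *)
Lemma relation0 d gen G (r : vec) : gen_system d gen G -> (forall i, size G < i -> r i = 0%R) ->
  relation d gen r -> r 0 = 0%R.
Proof.
move=> gs r0 /(_ [::]); rewrite (lcoef_gens _ gs (leqnn _) r0) big1 => [|i _].
  by rewrite /= mulr1 addr0.
by rewrite ncoef_mulx_nil mulr0.
Qed.

(** The relation is evaluated at [rcons u x]: the constant and the generators ending in other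
    variables vanish, and the rest contribute the coefficients of their prefixes at [u]. *)
Lemma prow_relation d gen G (r : vec) x J : gen_system d gen G -> J <= size G ->
  (forall i, J < i -> r i = 0%R) -> relation d gen r -> relation d gen (prow G r x J).
Proof.
move=> gs JG r0 rel u; rewrite -(rel (rcons u x)) (lcoef_gens _ gs JG r0).
rewrite [ncoef (NConst 1%R) _]/=; case: eqP => [/(congr1 size)|_]; first by rewrite size_rcons.
rewrite mulr0 add0r /lcoef /prow.
under [RHS]eq_bigr => j _ do rewrite /gform ncoef_mulx_rcons.
rewrite (eq_bigr (fun i : 'I_(2 ^ d) => (\sum_(j < J | gvar (nth gdef G j) == x)
    r j.+1 * grow (nth gdef G j) i * ncoef (gen i) u)%R)); last by move=> i _; rewrite mulr_suml.
rewrite exchange_big /= [RHS](bigID (fun j : 'I_J => gvar (nth gdef G j) == x)) /=.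
rewrite [X in (_ + X)%R]big1 ?addr0 => [|j /negbTE ne]; last first.
  by rewrite eq_sym ne !mulr0.
apply: eq_bigr => j /eqP e; rewrite e eqxx mulr1.
rewrite (gs_span gs); last by have := ltn_ord j; lia.
by rewrite mulr_sumr; apply: eq_bigr => i _; rewrite mulrA.
Qed.

(** Rows are triangular, so division strictly lowers the top generator; this drives the induction in
    [relation_basis]. *)
Lemma prow0 d gen G (r : vec) x J i : gen_system d gen G -> J <= size G -> J <= i ->
  prow G r x J i = 0%R.
Proof.
move=> gs JG Ji; rewrite /prow big1 // => j _.
by rewrite (gs_row gs) ?mulr0 //; have := ltn_ord j; lia.
Qed.

Lemma in_row_facts d gen G j : j < size G ->
  In (piff (bval d (gpre (nth gdef G j))) (lform d gen (grow (nth gdef G j))))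
    (row_facts d gen G).
Proof. by elim: G j => //= t G IH [|j] /=; [left|move/IH; right]. Qed.

(* Right division by [x], performed inside the derivation *)
Lemma prf_pvec d gen G H (r : vec) x J : gen_system d gen G -> J <= size G ->
  incl (row_facts d gen G) H ->
  prf (msize d) H (J * (2 ^ d * 11) + 2 ^ d * 5)
    [:: piff (lform d gen (pvec G r x J)) (PAnd (lform d gen (prow G r x J)) (bval d (NVar x)))].
Proof.
move=> gs JG iH; have d0 := expn_gt0 2 d; have s := gs_small gs.
have d1 : 1 < 2 ^ d by have := s 0; rewrite (gs_one gs).
have sx y : psize (bval d (NVar y)) <= msize d by apply: psize_bval_m.
elim: J JG => [_|J IH JG].
  apply: (@prf_le _ _ (2 ^ d * 2 + 2 ^ d * 2).+1); last by lia.
  apply: (prf_rule2 (P1 := PNot x0) (P2 := PNot x1) (T := piff x0 (PAnd x1 x2))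
    (sl := [:: lform d gen (pvec G r x 0); lform d gen (prow G r x 0); bval d (NVar x)])) => //.
  - by rewrite /= !psize_lform // sx.
  - by apply: prf_lzero => -[|i] _ //=; rewrite andbF.
  - by apply: prf_lzero => i _; rewrite /prow big_ord0.
set t := nth gdef G J; have {}IH := IH (ltnW JG).
(* If step [J] ends in another variable or has coefficient 0, neither vector changes; otherwise
   [pvec] gains [delta J.+1] and [prow] gains [grow t]. *)
have [/andP[/eqP gx /eqP r1]|nr] := boolP ((gvar t == x) && (r J.+1 == 1%R)); last first.
  rewrite (@eq_lform d gen _ (pvec G r x J)); last first.
    case=> [|i] _ //=; case: eqP => //= gx; rewrite ltnS leq_eqVlt.
    case: (i =P J) => //= e; rewrite e ltnn.
    move: gx; rewrite e -/t => gx.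
    by move: nr; rewrite gx eqxx /= => /eqP; case: (F2P (r J.+1)).
  rewrite (@eq_lform d gen (prow G r x J.+1) (prow G r x J)); last first.
    move=> i _; rewrite /prow big_mkcond big_ord_recr /= -big_mkcond /=.
    case: eqP => [gx|_]; last by rewrite addr0.
    move: nr; rewrite /t gx eqxx /=; case: (F2P (r J.+1)) => ->; last by rewrite eqxx.
    by rewrite mul0r addr0.
  by apply: prf_le IH _; lia.
have sQ : ncf_size (gpre t) + 2 < 2 ^ d.
  by have := s J.+1; rewrite (gs_step gs) //= -/t; lia.
have pd : prf (msize d) H (2 ^ d * 6) [:: piff (lform d gen (delta J.+1))
    (PAnd (lform d gen (grow t)) (bval d (NVar x)))].
  apply: (@prf_le _ _ (2 ^ d * 2 + 2 ^ d * 3 + 0).+1); last by lia.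
  apply: (prf_rule3 (P1 := piff x0 x1) (P2 := piff x1 (PAnd x2 x4)) (P3 := piff x2 x3)
    (T := piff x0 (PAnd x3 x4)) (sl := [:: lform d gen (delta J.+1); bval d (gform t);
    bval d (gpre t); lform d gen (grow t); bval d (NVar x)])); first by [].
  - by rewrite /= !psize_lform // sx !psize_bval_m //=; lia.
  - exact: ltnSn.
  - have := @prf_ldelta d H gen J.+1 s; rewrite (gs_step gs) // -/t; apply.
    by have := gs_size gs; lia.
  - by rewrite -gx; apply: prf_mul => /=; lia.
  - by apply: prf_hyp; apply: iH; apply: in_row_facts.
apply: (@prf_le _ _ (J * (2 ^ d * 11) + 2 ^ d * 5 + 2 ^ d * 2 + 2 ^ d * 2 + 2 ^ d * 6).+1).
  2: by lia.
apply: (prf_rule4 (P1 := piff x1 (PAnd x4 (PVar 6))) (P2 := piff x0 (pxor x1 x2))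
  (P3 := piff x3 (pxor x4 x5)) (P4 := piff x2 (PAnd x5 (PVar 6)))
  (T := piff x0 (PAnd x3 (PVar 6)))
  (sl := [:: lform d gen (pvec G r x J.+1); lform d gen (pvec G r x J); lform d gen (delta J.+1);
    lform d gen (prow G r x J.+1); lform d gen (prow G r x J); lform d gen (grow t);
    bval d (NVar x)])); first by [].
- by rewrite /= !psize_lform // sx.
- exact: ltnSn.
- exact: IH.
- apply: prf_ladd => // -[|i] _; first by rewrite /= /delta /= addr0.
  rewrite /= /delta eqSS ltnS [i <= J]leq_eqVlt; case: (i =P J) => [->|_] /=.
    by rewrite -/t gx eqxx ltnn andbF /= add0r r1.
  by rewrite addr0.
- apply: prf_ladd => // i _; rewrite /prow big_mkcond big_ord_recr /= -big_mkcond /=.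
  by rewrite -/t gx eqxx r1 mul1r.
- exact: pd.
Qed.

Lemma pvec_sum G (r : vec) : (forall i, size G < i -> r i = 0%R) -> r 0 = 0%R -> forall J,
  J <= size G -> (forall i, J < i -> r i = 0%R) -> forall i,
  r i = (\sum_(x <- undup (map gvar G)) pvec G r x J i)%R.
Proof.
move=> rG r0 J JG rJ [|i]; first by rewrite big1.
rewrite /=; case: (ltnP i J) => iJ; last by rewrite rJ // big1 // => x _; rewrite andbF.
rewrite (bigD1_seq (gvar (nth gdef G i))) ?undup_uniq //=; last first.
  by rewrite mem_undup -(nth_map gdef 0) ?mem_nth ?size_map //; lia.
by rewrite eqxx big1 ?addr0 // => x; rewrite eq_sym => /negbTE ->.
Qed.

(* A relation among the generators is reduced, by right division by each variable, to relations
   with a smaller top generator; over GF(2) one relation per top generator suffices. *)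
Lemma relation_basis d gen G H : gen_system d gen G -> 2 < 2 ^ d ->
  incl (row_facts d gen G) H -> forall K, K <= (size G).+1 ->
  exists B : seq vec,
    [/\ size B <= K,
        (forall r, relation d gen r -> (forall i, K <= i -> r i = 0%R) ->
          exists l, [/\ incl l B, size l <= K & forall i, r i = (\sum_(b <- l) b i)%R]) &
        prf (msize d) H (K * (2 ^ d * 2 ^ d * 2 ^ d * 30))
          (map (fun b => PNot (lform d gen b)) B)].
Proof.
move=> gs d2 iH; have s := gs_small gs; elim=> [_|K IH KG].
  exists [::]; split=> //; last by apply: prf_incl => A [].
  by move=> r _ r0; exists [::]; split=> // i; rewrite big_nil r0.
have [B [sB spB pB]] := IH (ltnW KG).
pose top r := [/\ relation d gen r, forall i, K < i -> r i = 0%R & r K = 1%R].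
(* If no relation has top generator [K], the list for smaller tops already suffices. *)
have [[rho [rel r0 r1]]|no] := classic (exists r, top r); last first.
  exists B; split; first exact: leqW.
    move=> r rel r0; have [|l [lB sl e]] := spB r rel.
      2: by exists l; split=> //; apply: leqW.
    move=> i; rewrite leq_eqVlt => /orP[/eqP <-|/r0 //].
    by case: (F2P (r K)) => // r1; case: no; exists r; split.
  by apply: prf_le pB _; rewrite leq_mul2r leqnSn orbT.
exists (rho :: B); split.
- by [].
- move=> r rel' r0'; case: (F2P (r K)) => rK.
    have [|l [lB sl e]] := spB r rel'.
      2: by exists l; split; [move=> b /lB; right|apply: leqW|].
    by move=> i; rewrite leq_eqVlt => /orP[/eqP <- //|/r0'].
  (* Both top coefficients are 1, so adding [rho] cancels them. *)
  have [||l [lB sl e]] := spB (fun i => r i + rho i)%R.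
  + by move=> w; rewrite lcoef_add rel rel' addr0.
  + move=> i; rewrite leq_eqVlt => /orP[/eqP <-|Ki]; first by rewrite rK r1 F2_addxx.
    by rewrite r0 // r0' // addr0.
  exists (rho :: l); split=> //.
    by move=> b [<-|/lB]; [left|right].
  by move=> i; rewrite big_cons -e addrC -addrA F2_addxx addr0.
have rG i : size G < i -> rho i = 0%R by move=> le; apply: r0; lia.
have rho0 := relation0 gs rG rel.
(* The quotient of [rho] by [x] is a sum of relations already refuted, so it is false, and with it
   the part of [rho] ending in [x]. *)
have part x : prf (msize d) (map (fun b => PNot (lform d gen b)) B ++ H) (2 ^ d * 2 ^ d * 20)
    [:: PNot (lform d gen (pvec G rho x K))].
  have [||l [lB sl e]] := spB (prow G rho x K).
  - exact: prow_relation.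
  - by move=> i; apply: prow0 gs KG.
  have pl := @prf_lsum d (map (fun b => PNot (lform d gen b)) B ++ H) gen 0 l (prow G rho x K) s.
  apply: (@prf_le _ _ (K * (2 ^ d * 11) + 2 ^ d * 5 +
    (size l * (0 + 2 ^ d * 2).+1 + 2 ^ d * 2)).+1).
    2: by have := gs_size gs; nia.
  apply: (prf_rule2 (P1 := piff x0 (PAnd x1 x2)) (P2 := PNot x1) (T := PNot x0)
    (sl := [:: lform d gen (pvec G rho x K); lform d gen (prow G rho x K); bval d (NVar x)])).
  - by [].
  - by rewrite /= !psize_lform // psize_bval_m //=; lia.
  - exact: ltnSn.
  - apply: (prf_pvec (G := G)) => //.
    by move=> A iA; apply: In_catI; right; apply: iH.
  - apply: pl => // b ib; apply: prf_hyp; apply: In_catI; left.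
    by apply: (In_map_f (fun b => PNot (lform d gen b))); apply: lB.
have prho : prf (msize d) (map (fun b => PNot (lform d gen b)) B ++ H)
    (2 ^ d * 2 ^ d * 2 ^ d * 30) [:: PNot (lform d gen rho)].
  (* Without a constant term, [rho] is the sum of its parts over the distinct last variables. *)
  pose l := map (fun x => pvec G rho x K) (undup (map gvar G)).
  have sl : size l <= size G.
    by rewrite size_map (leq_trans (size_undup _)) // size_map.
  apply: (prf_le (@prf_lsum d _ gen (2 ^ d * 2 ^ d * 20) l rho s _ _)).
  - by move=> b ib; have [x [<- _]] := In_map ib.
  - by move=> i _; rewrite big_map; apply: pvec_sum.
  - by have := gs_size gs; nia.
apply: (prf_weaken (prf_cut pB prho)) => //.
by rewrite mulSn addnC.
Qed.

Lemma pit (F : ncf nat) d H : (forall w, ncoef F w = 0%R) -> 3 * ncf_size F + 10 < 2 ^ d ->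
  prf (msize d) H (2 ^ d * 2 ^ d * 2 ^ d * 2 ^ d * 60) [:: PNot (bval d F)].
Proof.
move=> F0 Fd; have d0 := expn_gt0 2 d; have F1 := ncf_size_gt0 F.
(* Reading starts after the prefix 1, which is generator 0, so new generators are numbered from
   1. *)
have [|G [r [sG r0 bG tG hG]]] := @linearize F (NConst 1%R) 1 (delta 0).
  by case.
pose gen j := if j is j'.+1 then gform (nth gdef G j') else NConst 1%R.
have s : small_gens d gen.
  case=> [|j] /=; first lia; case: (ltnP j (size G)) => jG; last by rewrite nth_default //=; lia.
  by have := bG j jG; rewrite /=; lia.
have [||||sF spG pG] := hG d gen s; rewrite ?add1n //=; try lia.
  by move=> w; rewrite lcoef_delta.
have gs : gen_system d gen G.
  by split=> //; lia.
have p1 : prf (msize d) H (2 ^ d * 3) [:: piff (bval d (NConst 1%R)) (lform d gen (delta 0))].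
  apply: (prf_rule1 (P1 := piff x0 x1) (T := piff x1 x0)
    (sl := [:: lform d gen (delta 0); bval d (NConst 1%R)])); first by [].
  - by rewrite /= psize_lform // psize_bval_m //=; lia.
  - 2: exact: (@prf_ldelta d H gen 0).
  lia.
have {}pG := pG ([:: piff (bval d (NConst 1%R)) (lform d gen (delta 0))] ++ H)
  (or_introl (erefl _)).
have p2 := prf_cut p1 pG.
set H2 := (_ :: _) ++ [:: _] in p2.
have iH : incl (row_facts d gen G) (H2 ++ H).
  by move=> A iA; apply: In_catI; left; right; apply: In_catI; left.
have d2 : 2 < 2 ^ d by lia.
have [B [sB spB pB]] := relation_basis gs d2 iH (leqnn _).
have [||l [lB sl e]] := spB r.
- by move=> w; rewrite -sF ncoef_cmul F0 mulr0.
- by move=> i; apply: r0.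
have p3 := prf_cut p2 pB.
have pr : prf (msize d) ((map (fun b => PNot (lform d gen b)) B ++ H2) ++ H) (2 ^ d * 2 ^ d * 10)
    [:: PNot (bval d F)].
  apply: (@prf_le _ _ (2 ^ d * 3 + 2 ^ d * 2 + 0 + (size l * (0 + 2 ^ d * 2).+1 + 2 ^ d * 2)).+1).
    2: by nia.
  apply: (prf_rule4 (P1 := piff x0 (PAnd x1 x2)) (P2 := piff x1 (PNot PBot)) (P3 := piff x0 x3)
    (P4 := PNot x3) (T := PNot x2)
    (sl := [:: bval d (NMul (NConst 1%R) F); bval d (NConst 1%R); bval d F; lform d gen r])).
  - by [].
  - by rewrite /= psize_lform // !psize_bval_m //=; lia.
  - exact: ltnSn.
  - by apply: prf_mul => /=; lia.
  - by have := @prf_const d ((map (fun b => PNot (lform d gen b)) B ++ H2) ++ H) 1%R.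
  - by apply: prf_hyp; apply: In_catI; left; apply: In_catI; right; left.
  - apply: prf_lsum => // b ib; apply: prf_hyp; apply: In_catI; left; apply: In_catI; left.
    by apply: (In_map_f (fun b => PNot (lform d gen b))); apply: lB.
apply: (prf_cut1 p3 pr).
have sGD := gs_size gs.
have : (size G).+1 * (2 ^ d * 2 ^ d * 2 ^ d * 30) <= 2 ^ d * (2 ^ d * 2 ^ d * 2 ^ d * 30).
  by rewrite leq_mul2r sGD orbT.
nia.
Qed.

(** * The substituted axioms *)

Lemma F2_N1 : (-1 = 1 :> 'F_2)%R.
Proof. by case: (F2P (-1)%R) => // /eqP; rewrite oppr_eq0 oner_eq0. Qed.

Lemma expn2_msize d : 2 ^ d <= msize d.
Proof.
have : 2 ^ d <= 4 ^ d by elim: d => // d IH; rewrite !expnS; lia.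
by rewrite /msize; nia.
Qed.

Lemma psize_bigand s A : In A s -> psize A <= psize (bigand s).
Proof.
elim: s => //= B [_ [->|[]] //|C s IH [->|/IH]] /=; lia.
Qed.

Lemma size_bigor k : size k <= psize (bigor (map plit k)).
Proof.
elim: k => //= l [_|l' k IH] /=; first exact: psize_gt0.
by have := psize_gt0 (plit l); move: IH => /=; lia.
Qed.

Lemma prf_bigand m H n s A : In A s -> psize (bigand s) <= m ->
  prf m H n [:: bigand s] -> prf m H (n + size s * 2) [:: A].
Proof.
elim: s n => // B [|C s] IH n iA sm p.
  by case: iA p => [->|[]] p; apply: prf_le p _; lia.
have sm' : psize B <= m /\ psize (bigand (C :: s)) <= m by move: sm => /=; lia.
case: iA => [<-|iA].
  apply: (prf_rule1 (P1 := PAnd x0 x1) (T := x0) (sl := [:: B; bigand (C :: s)])); first by [].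
  - by rewrite /= sm'.1 sm'.2.
  - 2: exact: p.
  by rewrite /=; lia.
have p' : prf m H n.+1 [:: bigand (C :: s)].
  apply: (prf_rule1 (P1 := PAnd x0 x1) (T := x1) (sl := [:: B; bigand (C :: s)])); first by [].
  - by rewrite /= sm'.1 sm'.2.
  - 2: exact: p.
  by [].
by apply: prf_le (IH n.+1 iA sm'.2 p') _; rewrite /=; lia.
Qed.

(** In [tr], zero encodes truth: a positive literal becomes [1 - x] and a negative one [x], whence
    the negation. *)
Lemma prf_tr_lit d H l : 8 < 2 ^ d ->
  prf (msize d) H (2 ^ d * 15) [:: piff (bval d (tr_lit l)) (PNot (plit l))].
Proof.
case: l => i b d8; have md := expn2_msize d; rewrite /tr_lit /plit /=; case: b.
  rewrite F2_N1.
  apply: (@prf_le _ _ (2 ^ d * 5 + 2 ^ d * 3 + 2 ^ d * 2 + 2 ^ d * 2).+1); last by lia.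
  have p1 := prf_const d H 1%R; rewrite /pconst oner_eq0 in p1.
  apply: (prf_rule4 (P1 := piff x0 (pxor x1 x2)) (P2 := piff x2 (PAnd x1 x3))
    (P3 := piff x1 (PNot PBot)) (P4 := piff x3 x4) (T := piff x0 (PNot x4))
    (sl := [:: bval d (NAdd (NConst 1%R) (NMul (NConst 1%R) (NVar i))); bval d (NConst 1%R);
      bval d (NMul (NConst 1%R) (NVar i)); bval d (NVar i); PVar i])); first by [].
  - by rewrite /= !psize_bval_m //=; lia.
  - exact: ltnSn.
  - by apply: prf_add => /=; lia.
  - by apply: prf_mul => /=; lia.
  - exact: p1.
  - exact: prf_var.
apply: (@prf_le _ _ (2 ^ d * 2).+1); last by lia.
apply: (prf_rule1 (P1 := piff x0 x1) (T := piff x0 (PNot (PNot x1)))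
  (sl := [:: bval d (NVar i); PVar i])); first by [].
- by rewrite /= !psize_bval_m //=; lia.
- exact: ltnSn.
- exact: prf_var.
Qed.

Lemma ncf_size_tr k : ncf_size (tr k) <= 6 * size k + 1.
Proof.
elim: k => //= l k IH; have : ncf_size (tr_lit l) <= 5 by rewrite /tr_lit; case: ifP.
by lia.
Qed.

Lemma prf_tr d H k : 6 * size k + 8 < 2 ^ d -> psize (bigor (map plit k)) <= msize d ->
  prf (msize d) H (size k * (2 ^ d * 20) + 2 ^ d * 3)
    [:: piff (bval d (tr k)) (PNot (bigor (map plit k)))].
Proof.
move=> kd; have md := expn2_msize d; elim: k kd => [|l k IH] kd sk.
  have p1 := prf_const d H 1%R; rewrite /pconst oner_eq0 in p1.
  by apply: prf_le p1 _; rewrite /=; lia.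
have [sl sk'] : psize (plit l) <= msize d /\ psize (bigor (map plit k)) <= msize d.
  by case: k sk {IH kd} => [|l' k] /=; lia.
have kd' : 6 * size k + 8 < 2 ^ d by move: kd => /=; lia.
have {}IH := IH kd' sk'.
have tE : tr (l :: k) = NMul (tr_lit l) (tr k) by [].
have tk := ncf_size_tr (l :: k).
have [tl1 tl2] : ncf_size (tr_lit l) < ncf_size (tr (l :: k)) /\
    ncf_size (tr k) < ncf_size (tr (l :: k)) by rewrite tE /=; lia.
have pl : prf (msize d) H (2 ^ d * 15) [:: piff (bval d (tr_lit l)) (PNot (plit l))].
  by apply: prf_tr_lit; lia.
have pm : prf (msize d) H (2 ^ d * 3) [:: piff (bval d (tr (l :: k)))
    (PAnd (bval d (tr_lit l)) (bval d (tr k)))].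
  by rewrite tE; apply: prf_mul; rewrite tE in tk; move: kd tk => /=; lia.
have sb : [&& psize (bval d (tr (l :: k))) <= msize d, psize (bval d (tr_lit l)) <= msize d,
    psize (bval d (tr k)) <= msize d, psize (plit l) <= msize d &
    psize (bigor (map plit k)) <= msize d].
  by rewrite sl sk' !psize_bval_m //; lia.
apply: (@prf_le _ _ (2 ^ d * 3 + 2 ^ d * 15 + (size k * (2 ^ d * 20) + 2 ^ d * 3)).+1).
  2: by move: kd => /=; lia.
(* The last literal is treated apart because [bigor] of a singleton has no final [PBot]. *)
case: k IH sb pm {kd kd' sk sk' tk tE tl1 tl2} => [|l' k] IH sb pm.
  apply: (prf_rule3 (P1 := piff x0 (PAnd x1 x2)) (P2 := piff x1 (PNot x3))
    (P3 := piff x2 (PNot PBot)) (T := piff x0 (PNot x3))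
    (sl := [:: bval d (tr [:: l]); bval d (tr_lit l); bval d (tr [::]); plit l])) => //.
  by case/and5P: sb => h1 h2 h3 h4 _; rewrite /all h1 h2 h3 h4.
apply: (prf_rule3 (P1 := piff x0 (PAnd x1 x2)) (P2 := piff x1 (PNot x3))
  (P3 := piff x2 (PNot x4)) (T := piff x0 (PNot (POr x3 x4)))
  (sl := [:: bval d (tr (l :: l' :: k)); bval d (tr_lit l); bval d (tr (l' :: k)); plit l;
    bigor (map plit (l' :: k))])) => //.
by case/and5P: sb => h1 h2 h3 h4 h5; rewrite /all; apply/and5P; split=> //; rewrite andbT; exact: h5.
Qed.

Lemma ncf_size_subst V W (s : V -> ncf W) b F : (forall v, ncf_size (s v) <= b) -> 0 < b ->
  ncf_size (nsubst s F) <= ncf_size F * b.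
Proof.
move=> sb b0; elim: F => [v|a|g IHg h IHh|g IHg h IHh] //=; rewrite ?mul1n //.
all: by rewrite mulSn mulnDl; lia.
Qed.

Lemma prf_subst V (s1 s2 : V -> ncf nat) (C : ncf V) d H k b :
  (forall v, ncf_size (s1 v) <= b) -> (forall v, ncf_size (s2 v) <= b) -> 0 < b ->
  (forall v, prf (msize d) H k [:: piff (bval d (s1 v)) (bval d (s2 v))]) ->
  ncf_size C * b < 2 ^ d ->
  prf (msize d) H (ncf_size C * (k + 2 ^ d * 11))
    [:: piff (bval d (nsubst s1 C)) (bval d (nsubst s2 C))].
Proof.
move=> sb1 sb2 b0 pl; have d0 := expn_gt0 2 d; elim: C => [v|a|g IHg h IHh|g IHg h IHh] Cd.
- by apply: prf_le (pl v) _ => /=; lia.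
- apply: (prf_rule0 (T := piff x0 x0) (sl := [:: bval d (NConst a)])) => //=; last by lia.
  by rewrite psize_bval_m //; move: Cd => /=; lia.
all: have sg1 := ncf_size_subst g sb1 b0; have sg2 := ncf_size_subst g sb2 b0.
all: have sh1 := ncf_size_subst h sb1 b0; have sh2 := ncf_size_subst h sb2 b0.
all: have Cd' : ncf_size g * b + ncf_size h * b + b < 2 ^ d by move: Cd => /=; lia.
all: have {}IHg := IHg ltac:(lia); have {}IHh := IHh ltac:(lia).
- apply: (@prf_le _ _ (2 ^ d * 5 + 2 ^ d * 5 + ncf_size g * (k + 2 ^ d * 11) +
    ncf_size h * (k + 2 ^ d * 11)).+1); last by rewrite /= mulSn mulnDl; lia.
  apply: (prf_rule4 (P1 := piff x0 (pxor x1 x2)) (P2 := piff x3 (pxor x4 x5))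
    (P3 := piff x1 x4) (P4 := piff x2 x5) (T := piff x0 x3)
    (sl := [:: bval d (nsubst s1 (NAdd g h)); bval d (nsubst s1 g); bval d (nsubst s1 h);
      bval d (nsubst s2 (NAdd g h)); bval d (nsubst s2 g); bval d (nsubst s2 h)])) => //.
  + by rewrite /= !psize_bval_m //=; lia.
  + by apply: (@prf_add d H (nsubst s1 g) (nsubst s1 h)); lia.
  + by apply: (@prf_add d H (nsubst s2 g) (nsubst s2 h)); lia.
- apply: (@prf_le _ _ (2 ^ d * 3 + 2 ^ d * 3 + ncf_size g * (k + 2 ^ d * 11) +
    ncf_size h * (k + 2 ^ d * 11)).+1); last by rewrite /= mulSn mulnDl; lia.
  apply: (prf_rule4 (P1 := piff x0 (PAnd x1 x2)) (P2 := piff x3 (PAnd x4 x5))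
    (P3 := piff x1 x4) (P4 := piff x2 x5) (T := piff x0 x3)
    (sl := [:: bval d (nsubst s1 (NMul g h)); bval d (nsubst s1 g); bval d (nsubst s1 h);
      bval d (nsubst s2 (NMul g h)); bval d (nsubst s2 g); bval d (nsubst s2 h)])) => //.
  + by rewrite /= !psize_bval_m //=; lia.
  + by apply: (@prf_mul d H (nsubst s1 g) (nsubst s1 h)); lia.
  + by apply: (@prf_mul d H (nsubst s2 g) (nsubst s2 h)); lia.
Qed.

Lemma prf_nsub d H n f g : ncf_size f + ncf_size g + 4 < 2 ^ d ->
  prf (msize d) H n [:: piff (bval d f) (bval d g)] ->
  prf (msize d) H (n + 2 ^ d * 14) [:: piff (bval d (nsub f g)) (bval d (NConst 0%R))].
Proof.
move=> sz p; rewrite /nsub F2_N1; have := ncf_size_gt0 f; have := ncf_size_gt0 g => g0 f0.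
have p1 := prf_const d H 1%R; rewrite /pconst oner_eq0 in p1.
have q0 := prf_const d H 0%R; rewrite /pconst eqxx in q0.
have p2 : prf (msize d) H (2 ^ d * 6) [:: piff (bval d (NMul (NConst 1%R) g)) (bval d g)].
  apply: (@prf_le _ _ (2 ^ d * 3 + 2 ^ d * 2).+1); last by lia.
  apply: (prf_rule2 (P1 := piff x0 (PAnd x1 x2)) (P2 := piff x1 (PNot PBot))
    (T := piff x0 x2) (sl := [:: bval d (NMul (NConst 1%R) g); bval d (NConst 1%R); bval d g]))
    => //.
  - by rewrite /= !psize_bval_m //=; lia.
  - by apply: prf_mul => /=; lia.
apply: (@prf_le _ _ (2 ^ d * 5 + 2 ^ d * 6 + n + 2 ^ d * 2).+1); last by lia.
apply: (prf_rule4 (P1 := piff x0 (pxor x1 x2)) (P2 := piff x2 x3) (P3 := piff x1 x3)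
  (P4 := piff x4 PBot) (T := piff x0 x4)
  (sl := [:: bval d (NAdd f (NMul (NConst 1%R) g)); bval d f; bval d (NMul (NConst 1%R) g);
    bval d g; bval d (NConst 0%R)])) => //.
- by rewrite /= !psize_bval_m //=; lia.
- by apply: prf_add => /=; lia.
Qed.

Lemma prf_refl d H n F : ncf_size F < 2 ^ d -> 0 < n ->
  prf (msize d) H n [:: piff (bval d F) (bval d F)].
Proof.
move=> sF n0; apply: (prf_rule0 (T := piff x0 x0) (sl := [:: bval d F])) => //=.
by rewrite psize_bval_m.
Qed.

Lemma psize_clause phi i : i < size phi ->
  psize (bigor (map plit (nth [::] phi i))) <= cnf_size phi.
Proof.
move=> ip; apply: psize_bigand; elim: phi i ip => // k phi IH [|i] ip /=; first by left.
by right; apply: IH.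
Qed.

Lemma ncf_size_axioms phi v :
  ncf_size (subst_axioms (nvars phi) (map tr phi) v) <= 6 * cnf_size phi + 9.
Proof.
case: v => [[[i|i]|i]|[i j]] /=; try by case: ifP => _ /=; lia.
  by lia.
case: ifP => [|_] /=; last by lia.
rewrite size_map => ip; rewrite (nth_map [::]) //.
have := ncf_size_tr (nth [::] phi i); have := psize_clause ip.
by have := size_bigor (nth [::] phi i); lia.
Qed.

(** A clause axiom is false because its clause is a conjunct of the hypothesis; the Boolean and
    commutator axioms are false by idempotence and commutativity of [PAnd]. *)
Lemma prf_axioms d phi v : 6 * cnf_size phi + 20 < 2 ^ d ->
  prf (msize d) [:: cnf_form phi] (2 ^ d * 2 ^ d * 30)
    [:: piff (bval d (subst_axioms (nvars phi) (map tr phi) v)) (bval d (subst_zero v))].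
Proof.
move=> sd; have md := expn2_msize d.
have D2 : 2 ^ d * 26 <= 2 ^ d * 2 ^ d.
  by rewrite leq_mul2l; have := psize_gt0 (cnf_form phi); rewrite -/(cnf_size phi); lia.
case: v => [[[i|i]|i]|[i j]] /=.
- by apply: prf_refl => /=; lia.
- case: ifP => [|_]; last by apply: prf_refl => /=; lia.
  rewrite size_map => ip; rewrite (nth_map [::]) //; set k := nth [::] phi i.
  have sk : psize (bigor (map plit k)) <= cnf_size phi by apply: psize_clause.
  have szk := size_bigor k.
  have sphi : size phi <= cnf_size phi.
    rewrite /cnf_size /cnf_form; elim: (phi) => // c [|c' l] IH /=; first exact: psize_gt0.
    by move: IH => /=; lia.
  have pk : prf (msize d) [:: cnf_form phi] (0 + size phi * 2) [:: bigor (map plit k)].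
    rewrite -(size_map (fun k => bigor (map plit k)) phi); apply: prf_bigand.
    + rewrite /k; elim: (phi) (i) ip => // c l IH [|i'] ip /=; first by left.
      by right; apply: IH.
    + by rewrite -/(cnf_form phi) -/(cnf_size phi); lia.
    + by apply: prf_hyp; left.
  have pt := @prf_tr d [:: cnf_form phi] k.
  have q0 := prf_const d [:: cnf_form phi] 0%R; rewrite /pconst eqxx in q0.
  have st := ncf_size_tr k.
  apply: (@prf_le _ _ ((0 + size phi * 2) + (size k * (2 ^ d * 20) + 2 ^ d * 3) + 2 ^ d * 2).+1).
    2: by nia.
  apply: (prf_rule3 (P1 := x1) (P2 := piff x0 (PNot x1)) (P3 := piff x2 PBot) (T := piff x0 x2)
    (sl := [:: bval d (tr k); bigor (map plit k); bval d (NConst 0%R)])) => //.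
  + rewrite /= !psize_bval_m //=; last by lia.
      by rewrite (leq_trans sk) //; lia.
    by lia.
  + by apply: pt; lia.
- case: ifP => _; last by apply: prf_refl => /=; lia.
  apply: (@prf_le _ _ ((2 ^ d * 3).+1 + 2 ^ d * 14)); last by lia.
  apply: prf_nsub => /=; first by lia.
  apply: (prf_rule1 (P1 := piff x0 (PAnd x1 x1)) (T := piff x0 x1)
    (sl := [:: bval d (NMul (NVar i) (NVar i)); bval d (NVar i)])); first by [].
  + by rewrite /= !psize_bval_m //=; lia.
  + exact: ltnSn.
  + by apply: prf_mul => /=; lia.
- case: ifP => _; last by apply: prf_refl => /=; lia.
  apply: (@prf_le _ _ ((2 ^ d * 3 + 2 ^ d * 3).+1 + 2 ^ d * 14)); last by lia.
  apply: prf_nsub => /=; first by lia.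
  apply: (prf_rule2 (P1 := piff x0 (PAnd x1 x2)) (P2 := piff x3 (PAnd x2 x1)) (T := piff x0 x3)
    (sl := [:: bval d (NMul (NVar i) (NVar j)); bval d (NVar i); bval d (NVar j);
      bval d (NMul (NVar j) (NVar i))])); first by [].
  + by rewrite /= !psize_bval_m //=; lia.
  + exact: ltnSn.
  + by apply: prf_mul => /=; lia.
  + by apply: prf_mul => /=; lia.
Qed.

(** * Refutation of the CNF and the final size estimate *)

Lemma refute_cnf d phi C : nc_ips_refutation (nvars phi) (map tr phi) C ->
  3 * (ncf_size C * (6 * cnf_size phi + 9)) + 20 < 2 ^ d ->
  prf (msize d) [:: cnf_form phi] (2 ^ d * 2 ^ d * 2 ^ d * 2 ^ d * 200) [:: PBot].
Proof.
move=> [C0 C1] sd; have md := expn2_msize d; have nC := ncf_size_gt0 C.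
set b := 6 * cnf_size phi + 9 in sd.
have b9 : 9 <= b by rewrite /b; lia.
have bC : b <= ncf_size C * b by nia.
set F0 := nsubst subst_zero C; set F1 := nsubst (subst_axioms (nvars phi) (map tr phi)) C.
have szero v : ncf_size (subst_zero v) <= b by case: v => [[[]|]|] /=; lia.
have sax v : ncf_size (subst_axioms (nvars phi) (map tr phi) v) <= b by apply: ncf_size_axioms.
have b0 : 0 < b by lia.
have s0 : ncf_size F0 <= ncf_size C * b by apply: ncf_size_subst.
have s1 : ncf_size F1 <= ncf_size C * b by apply: ncf_size_subst.
have p0 : prf (msize d) [:: cnf_form phi] (2 ^ d * 2 ^ d * 2 ^ d * 2 ^ d * 60)
    [:: PNot (bval d F0)].
  by apply: pit; [move=> w; rewrite C0 /=; case: ifP|lia].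
have p1 : prf (msize d) [:: cnf_form phi] (2 ^ d * 2 ^ d * 2 ^ d * 2 ^ d * 60)
    [:: PNot (bval d (NAdd F1 (NConst 1%R)))].
  by apply: pit; [move=> w; rewrite /= C1 F2_addxx|rewrite /=; lia].
have p01 : prf (msize d) [:: cnf_form phi] (ncf_size C * (2 ^ d * 2 ^ d * 30 + 2 ^ d * 11))
    [:: piff (bval d F1) (bval d F0)].
  by apply: (prf_subst (b := b)) => // [v|]; [apply: prf_axioms; lia|lia].
have pa : prf (msize d) [:: cnf_form phi] (2 ^ d * 5)
    [:: piff (bval d (NAdd F1 (NConst 1%R))) (pxor (bval d F1) (bval d (NConst 1%R)))].
  by apply: prf_add => /=; lia.
have q1 := prf_const d [:: cnf_form phi] 1%R; rewrite /pconst oner_eq0 in q1.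
apply: (prf_rule5 (P1 := PNot x0) (P2 := PNot x1) (P3 := piff x2 x0) (P4 := piff x1 (pxor x2 x3))
  (P5 := piff x3 (PNot PBot)) (T := PBot)
  (sl := [:: bval d F0; bval d (NAdd F1 (NConst 1%R)); bval d F1; bval d (NConst 1%R)]) _ _ _
  p0 p1 p01 pa q1) => //.
- by rewrite /= !psize_bval_m //=; lia.
have h1 : ncf_size C * (2 ^ d * 2 ^ d * 30 + 2 ^ d * 11) <= 2 ^ d * 2 ^ d * 2 ^ d * 41.
  have h : ncf_size C <= 2 ^ d by nia.
  apply: leq_trans (leq_mul h (leqnn _)) _; nia.
move: (2 ^ d) h1 sd bC b9 => D; nia.
Qed.

(** One level multiplies by at most [4 ^ d * 2 ^ d * 4], that is [2 ^ (3 * d + 2)]; after [d] levels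
    the exponent is quadratic in [d]. *)
Lemma vbound_le d e : vbound d e + 4 <= 2 ^ ((3 * d + 2) * e + 2).
Proof.
elim: e => [|e IH]; first by rewrite muln0.
have -> : (3 * d + 2) * e.+1 + 2 = d + d + d + 2 + ((3 * d + 2) * e + 2) by lia.
rewrite [in X in _ <= X]expnD.
have -> : 2 ^ (d + d + d + 2) = 2 ^ d * 2 ^ d * 2 ^ d * 4 by rewrite !expnD.
have e4 : 4 ^ d = 2 ^ d * 2 ^ d by rewrite -(expnMn 2 2).
have d0 := expn_gt0 2 d.
rewrite /= e4; apply: leq_trans (leq_mul (leqnn _) IH).
move: (2 ^ d) d0 => D d0; move: (vbound d e) => u.
have D0 : 0 < D by [].
have h2 : 1 <= D * D by nia.
have h3 : D * D <= D * D * D by nia.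
nia.
Qed.

Lemma msize_le d : msize d <= 2 ^ (3 * d * d + 4 * d + 2).
Proof.
rewrite /msize /vsize -addnA; have := vbound_le d d.
have -> : 3 * d * d + 4 * d + 2 = (d + d) + ((3 * d + 2) * d + 2) by lia.
have -> : 4 ^ d = 2 ^ (d + d) by rewrite expnD -(expnMn 2 2).
by rewrite (expnD 2 (d + d) ((3 * d + 2) * d + 2)) => h; rewrite leq_mul2l h orbT.
Qed.

Theorem theorem4p3 :
  exists c : nat,
  forall (phi : cnf) (C : ncf ipsvar),
    ~ satisfiable phi ->
    nc_ips_refutation (nvars phi) (map tr phi) C ->
    let N := ncf_size C + cnf_size phi in
    exists pf : seq pform,
      frege_proof pf (PNot (cnf_form phi)) /\
      proof_size pf <= c * N ^ (c * (trunc_log 2 N).+1).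
Proof.
have [c hc] := chain_frege.
exists (c + 2000) => phi C _ ref N.
have N2 : 2 <= N.
  by have := ncf_size_gt0 C; have := psize_gt0 (cnf_form phi); rewrite /N /cnf_size; lia.
set t := (trunc_log 2 N).+1; have Nt : N < 2 ^ t by apply: trunc_log_ltn.
(* Used at the end to turn powers of 2 into powers of [N]. *)
have tN : 2 ^ t <= N ^ 2.
  have le : 2 ^ trunc_log 2 N <= N by apply: trunc_logP; lia.
  by rewrite /t expnS -mulnn leq_mul.
(* The requirement on [2 ^ d] is quadratic in [N]; as [N] is at least 2, [N ^ 8] exceeds it with a
   factor [2 ^ 6] to spare for the constants. *)
pose d := 8 * t.
have Nd : N ^ 8 <= 2 ^ d by rewrite /d mulnC expnM leq_exp2r // ltnW.
have sd : 3 * (ncf_size C * (6 * cnf_size phi + 9)) + 20 < 2 ^ d.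
  have h : 64 * (N * N) <= N ^ 8.
    have -> : N ^ 8 = N ^ 6 * (N * N) by rewrite mulnn -expnD.
    by apply: leq_mul => //; rewrite -[64]/(2 ^ 6) leq_exp2r.
  have := ncf_size_gt0 C; have := psize_gt0 (cnf_form phi).
  by rewrite -/(cnf_size phi); move: Nd h N2; rewrite /N; nia.
have [l [ch sl il]] := refute_cnf ref sd.
have sH : psize (cnf_form phi) <= msize d.
  by have := expn2_msize d; have := ncf_size_gt0 C; rewrite -/(cnf_size phi); nia.
have iB : In PBot (l ++ [:: cnf_form phi]) by apply: il; left.
have [pf [fp sz]] := hc _ _ _ ch sH iB.
exists pf; split=> //; apply: leq_trans sz _.
have e1 : (size l).+1 <= 2 ^ (4 * d + 8).
  have -> : 2 ^ (4 * d + 8) = 2 ^ d * 2 ^ d * 2 ^ d * 2 ^ d * 256.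
    by rewrite -!expnD (_ : 256 = 2 ^ 8) // -expnD; congr (2 ^ _); lia.
  have d0 : 0 < 2 ^ d * 2 ^ d * 2 ^ d * 2 ^ d by rewrite !muln_gt0 !expn_gt0.
  by lia.
have e2 : (size l).+1 * msize d <= N ^ (2000 * t).
  apply: leq_trans (leq_mul e1 (msize_le d)) _; rewrite -expnD.
  (* With [d = 8 * t] the exponents add up to [192 * t ^ 2 + 64 * t + 10], well below
     [1000 * t ^ 2]; [2 ^ t <= N ^ 2] then doubles 1000 to 2000. *)
  apply: (@leq_trans (2 ^ (t * (1000 * t)))).
    by rewrite leq_exp2l // /d; have : 1 <= t by []; nia.
  have -> : 2000 * t = 2 * (1000 * t) by lia.
  by rewrite !(expnM _ _ (1000 * t)) leq_exp2r // muln_gt0.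
have e3 : N ^ (2000 * t) <= N ^ ((c + 2000) * t).
  by rewrite leq_pexp2l ?leq_mul2r ?leq_addl ?orbT //; lia.
rewrite -mulnA; apply: leq_mul; first exact: leq_addr.
exact: leq_trans e2 e3.
Qed.
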